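(* Let $P$ be a parabolic subgroup of $G$ containing $B$. Identify $H^*_T(G/P)$ and $H^*_T(P/B)$ with the $\mathbb{C}[\mathfrak{t}^*]$-submodules $\mathrm{span}_{\mathbb{C}[\mathfrak{t}^*]}\langle \sigma_v : v\in W^P\rangle$ and $\mathrm{span}_{\mathbb{C}[\mathfrak{t}^*]}\langle \sigma_w : w\in W_P\rangle$ of $H^*_T(G/B)$, respectively. Then the multiplication map $p\otimes q\mapsto pq$ (product taken in the ring $H^*_T(G/B)$) induces a bilinear isomorphism of $\mathbb{C}[\mathfrak{t}^*]$-modules $$H^*_T(G/P)\otimes_{\mathbb{C}[\mathfrak{t}^*]} H^*_T(P/B)\;\cong\; H^*_T(G/B).$$
   Context: $G$ is a complex reductive linear algebraic group, $B$ a fixed Borel subgroup, $T\subseteq B$ the maximal torus, $W$ the Weyl group with simple reflections $s_1,\dots,s_n$ corresponding to the simple roots $\alpha_1,\dots,\alpha_n$, and $\ell$ the length function. For a parabolic subgroup $P\supseteq B$, $W_P\subseteq W$ is the associated subgroup (the Weyl group of $P/B$, generated by the simple reflections it contains), and $W^P$ is the set of minimal-length representatives of the cosets in $W/W_P$. $T$ acts by left multiplication; cohomology has coefficients in $\mathbb{C}$, and $\mathbb{C}[\mathfrak{t}^*]=H^*_T(pt)$ is the polynomial ring (symmetric algebra) on $\mathfrak{t}^*$, containing the roots as degree-one elements. The $T$-fixed points of $G/B$ are identified with $W$. Restriction to fixed points is injective, so $H^*_T(G/B)$ is regarded as a $\mathbb{C}[\mathfrak{t}^*]$-subalgebra of the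 ring of functions $W\to\mathbb{C}[\mathfrak{t}^*]$ with pointwise operations. It is a free $\mathbb{C}[\mathfrak{t}^*]$-module with basis the equivariant Schubert classes $\{\sigma_w : w\in W\}$, given by Billey's formula: for $u\in W$ with any fixed reduced word $u=s_{b_1}\cdots s_{b_{\ell(u)}}$, set $\mathbf{r}(\mathbf{i},u)=s_{b_1}\cdots s_{b_{i-1}}(\alpha_{b_i})$; then $$\sigma_v(u)=\sum \prod_{i=1}^{\ell(v)}\mathbf{r}(\mathbf{j_i},u),$$ where the sum is over all $1\le j_1<\dots<j_{\ell(v)}\le \ell(u)$ such that $s_{b_{j_1}}\cdots s_{b_{j_{\ell(v)}}}$ is a reduced word for $v$. $H^*_T(G/P)$ (respectively $H^*_T(P/B)$) is likewise a free $\mathbb{C}[\mathfrak{t}^*]$-module with basis of equivariant Schubert classes indexed by $W^P$ (respectively $W_P$), whose restrictions to fixed points are given by the same formula. Sending each Schubert class of $G/P$ or of $P/B$ to the class $\sigma_w\in H^*_T(G/B)$ with the same index is a module isomorphism onto its image; this is the identification used. For $G/P$ it is a homomorphism of modules only, not of rings. *)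

(* Defs.v *)
From HB Require Import structures.
From mathcomp Require Import all_boot all_order all_fingroup all_algebra.
From mathcomp Require Import ring_quotient.
From mathcomp Require Import boolp reals complex.
From mathcomp Require Import freeg mpoly.

Set Implicit Arguments.
Unset Strict Implicit.
Unset Printing Implicit Defensive.

Import GRing.Theory.
Local Open Scope ring_scope.
Local Open Scope quotient_scope.

(* Characters and cocharacters of T are both identified with Z^rank, the      *)
(* perfect pairing between them being the standard one.                       *)
Definition pairing n (x y : 'rV[int]_n) : int := \sum_j x 0 j * y 0 j.

(* A triple (G, B, T) enters only through its reduced root datum, together    *)
(* with the base of simple roots determined by B.                             *)
Record rootDatum := RootDatum {
  rank : nat;
  roots : seq 'rV[int]_rank;
  (* only the values at the roots matter *)
  coroot : 'rV[int]_rank -> 'rV[int]_rank;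
  coroot_inj : {in roots &, injective coroot};
  pairing_coroot : {in roots, forall a, pairing a (coroot a) = 2};
  reflection_roots : {in roots &, forall a b,
    b - pairing b (coroot a) *: a \in roots};
  reflection_coroots : {in roots &, forall a b,
    coroot b - pairing a (coroot b) *: coroot a \in map coroot roots};
  roots_reduced : {in roots, forall a, a *+ 2 \notin roots};
  ss_rank : nat;
  simple : 'I_ss_rank -> 'rV[int]_rank;
  simple_in_roots : forall i, simple i \in roots;
  simple_free : forall c : 'I_ss_rank -> int,
    \sum_i c i *: simple i = 0 -> forall i, c i = 0;
  simple_span : {in roots, forall a, exists c : 'I_ss_rank -> nat,
    a = \sum_i simple i *+ c i \/ a = - \sum_i simple i *+ c i}
}.

Section Weyl.
Variable D : rootDatum.

Definition root_type : finType := seq_sub (roots D).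

Definition reflection_fun (a b : root_type) : root_type :=
  SeqSub (reflection_roots (ssvalP a) (ssvalP b)).

Lemma reflection_funK a : involutive (reflection_fun a).
Proof.
move=> b; apply: val_inj; rewrite /=.
set c := pairing (ssval b) (coroot (ssval a)).
have -> : pairing (ssval b - c *: ssval a) (coroot (ssval a)) = - c.
  rewrite /pairing; under eq_bigr => j _ do rewrite !mxE mulrBl -mulrA.
  rewrite sumrB -mulr_sumr -!/(pairing _ _) pairing_coroot ?ssvalP //.
  by rewrite -/c mulrDr mulr1 opprD addrA subrr add0r.
by rewrite scaleNr opprK subrK.
Qed.

Definition reflection (a : root_type) : {perm root_type} :=
  perm (inv_inj (reflection_funK a)).

(* W acts faithfully on the roots, so it is realized as the group of          *)
(* permutations of the roots generated by all the reflections.                *)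
Definition weyl_group : {group {perm root_type}} :=
  <<[set reflection a | a : root_type]>>%G.

Definition weyl : finGroupType := subg_of weyl_group.

Definition simple_root (i : 'I_(ss_rank D)) : root_type :=
  SeqSub (simple_in_roots i).

Definition srefl (i : 'I_(ss_rank D)) : weyl :=
  subg weyl_group (reflection (simple_root i)).

(* (s * t) x = t (s x) for permutations; evaluating at the inverse gives the  *)
(* left action, act (u * v) b = act u (act v b), for which srefl i acts as    *)
(* the reflection in the i-th simple root.                                    *)
Definition act (w : weyl) (b : root_type) : root_type := (sgval w)^-1%g b.

Lemma act_mul u v b : act (u * v)%g b = act u (act v b).
Proof. by rewrite /act invMg permM. Qed.

Lemma act_srefl i b : act (srefl i) b = reflection_fun (simple_root i) b.
Proof.
rewrite /act /srefl subgK; last by apply/mem_gen/imset_f.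
by apply: (@perm_inj _ (reflection (simple_root i)));
  rewrite permKV permE reflection_funK.
Qed.

Definition word_prod (s : seq 'I_(ss_rank D)) : weyl :=
  (\prod_(i <- s) srefl i)%g.

(* The partial products of a shortest word are pairwise distinct, so a        *)
(* shortest word for w has size less than #|W|.                               *)
Definition length (w : weyl) : nat :=
  find (fun k => [exists s : k.-tuple 'I_(ss_rank D), word_prod s == w])
       (iota 0 #|weyl|).

Definition reduced_word (s : seq 'I_(ss_rank D)) (w : weyl) : bool :=
  (word_prod s == w) && (size s == length w).

(* Standard parabolic subgroups P correspond to the sets J of simple          *)
(* reflections contained in W_P.                                              *)
Definition parabolic (J : {set 'I_(ss_rank D)}) : {group weyl} :=
  <<[set srefl j | j in J]>>%G.

Definition min_reps (J : {set 'I_(ss_rank D)}) : {set weyl} :=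
  [set v | [forall x in parabolic J, length v <= length (v * x)%g]%N].

End Weyl.

Section Schubert.
Variables (R : realType) (D : rootDatum).

(* C[t^*], on the basis of t^* given by the standard basis of characters.     *)
Definition symalg : comNzRingType := {mpoly R[i][rank D]}.

Definition root_poly (b : root_type D) : symalg :=
  \sum_j (ssval b 0 j)%:~R *: 'X_j.

(* symalg^o is symalg as a module over itself; both the product and the       *)
(* scaling of weyl_fun are pointwise.                                         *)
Definition weyl_fun : Type := {ffun weyl D -> symalg^o}.
HB.instance Definition _ := GRing.PzRing.on weyl_fun.
HB.instance Definition _ := GRing.Lmodule.on weyl_fun.

(* r(i, u), for the word s of u and i counted from 0.                         *)
Definition inversion (s : seq 'I_(ss_rank D)) (i : 'I_(size s)) : root_type D :=
  act (word_prod (take i s)) (simple_root (tnth (in_tuple s) i)).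

(* A sequence of positions j_1 < j_2 < ... is encoded as the set of its       *)
(* terms; enum lists the elements of K in increasing order.                   *)
Definition billey (s : seq 'I_(ss_rank D)) (v : weyl D) : symalg :=
  \sum_(K : {set 'I_(size s)}
        | reduced_word [seq tnth (in_tuple s) k | k <- enum K] v)
    \prod_(k in K) root_poly (inversion k).

Definition schubert (rw : weyl D -> seq 'I_(ss_rank D)) (v : weyl D) :
  weyl_fun := [ffun u => billey (rw u) v].

End Schubert.

Section Span.
Variables (S : pzRingType) (V : lmodType S) (I : finType).
Variables (A : {set I}) (e : I -> V).

Definition mspan : {pred V} :=
  fun x => `[< exists c : I -> S, x = \sum_(i in A) c i *: e i >].

Lemma mspan_submod_closed : submod_closed mspan.
Proof.
split.
  by apply/asboolP; exists (fun=> 0); rewrite big1 // => i _; rewrite scale0r.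
move=> a _ _ /asboolP[c ->] /asboolP[d ->]; apply/asboolP.
exists (fun i => a * c i + d i); rewrite scaler_sumr -big_split /=.
by apply: eq_bigr => i _; rewrite scalerDl scalerA.
Qed.

HB.instance Definition _ := GRing.isSubmodClosed.Build S V mspan
  mspan_submod_closed.

Definition span_type := {x : V | x \in mspan}.
HB.instance Definition _ := SubChoice.on span_type.
HB.instance Definition _ :=
  [SubChoice_isSubLmodule of span_type by <:].

End Span.

Section Tensor.
Variables (S : comNzRingType) (M N : lmodType S).

Local Notation free := {freeg (M * N)%type / S}.

Inductive tensor_rel : free -> Prop :=
| TRzero : tensor_rel 0
| TRlin a x y : tensor_rel x -> tensor_rel y -> tensor_rel (a *: x + y)
| TRleft a m m' n : tensor_rel
    (<< (a *: m + m', n) >> - (a *: << (m, n) >> + << (m', n) >>))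
| TRright a m n n' : tensor_rel
    (<< (m, a *: n + n') >> - (a *: << (m, n) >> + << (m, n') >>)).

Definition tensor_relb : {pred free} := fun x => `[< tensor_rel x >].

Lemma tensor_relb_submod_closed : submod_closed tensor_relb.
Proof.
split; first exact/asboolP/TRzero.
by move=> a x y /asboolP hx /asboolP hy; apply/asboolP/TRlin.
Qed.

HB.instance Definition _ := GRing.isSubmodClosed.Build S free tensor_relb
  tensor_relb_submod_closed.

Definition tensor : Type := {ideal_quot tensor_relb}.
HB.instance Definition _ := GRing.Zmodule.on tensor.

Let pi_t (x : free) : tensor := \pi_{ideal_quot tensor_relb} x.

Let pi_tP x y : reflect (pi_t x = pi_t y) (x - y \in tensor_relb).
Proof. by rewrite Quotient.idealrBE; exact: eqP. Qed.

Let pi_tD x y : pi_t (x + y) = pi_t x + pi_t y.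
Proof. exact: Quotient.pi_add. Qed.

Definition tensor_scale (a : S) (t : tensor) : tensor :=
  pi_t (a *: generic_quotient.repr (t : {ideal_quot tensor_relb})).

Let tensor_scale_pi a x : tensor_scale a (pi_t x) = pi_t (a *: x).
Proof.
by apply/pi_tP; rewrite -scalerBr rpredZ //; apply/pi_tP; exact: reprK.
Qed.

Let pi_t_surj t : exists x, t = pi_t x.
Proof. by exists (generic_quotient.repr (t : {ideal_quot tensor_relb})); rewrite /pi_t reprK. Qed.

Let tensor_scaleA a b t :
  tensor_scale a (tensor_scale b t) = tensor_scale (a * b) t.
Proof. by have [x ->] := pi_t_surj t; rewrite !tensor_scale_pi scalerA. Qed.

Let tensor_scale1 : left_id 1 tensor_scale.
Proof. by move=> t; have [x ->] := pi_t_surj t; rewrite tensor_scale_pi scale1r. Qed.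

Let tensor_scaleDr : right_distributive tensor_scale +%R.
Proof.
move=> a t u; have [x ->] := pi_t_surj t; have [y ->] := pi_t_surj u.
by rewrite -pi_tD !tensor_scale_pi scalerDr pi_tD.
Qed.

Let tensor_scaleDl t : {morph tensor_scale^~ t : a b / a + b}.
Proof.
move=> a b; have [x ->] := pi_t_surj t.
by rewrite /= !tensor_scale_pi scalerDl pi_tD.
Qed.

HB.instance Definition _ := GRing.Zmodule_isLmodule.Build S tensor
  tensor_scaleA tensor_scale1 tensor_scaleDr tensor_scaleDl.

Let pi_tZ a x : a *: pi_t x = pi_t (a *: x).
Proof. exact: tensor_scale_pi. Qed.

Definition tens (m : M) (n : N) : tensor := pi_t << (m, n) >>.

Lemma tensDl a m m' n : tens (a *: m + m') n = a *: tens m n + tens m' n.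
Proof.
by rewrite /tens pi_tZ -pi_tD; apply/pi_tP/asboolP; exact: TRleft.
Qed.

Lemma tensDr a m n n' : tens m (a *: n + n') = a *: tens m n + tens m n'.
Proof.
by rewrite /tens pi_tZ -pi_tD; apply/pi_tP/asboolP; exact: TRright.
Qed.

Lemma tensor_ind (Q : tensor -> Prop) :
  Q 0 -> (forall a m n t, Q t -> Q (a *: tens m n + t)) -> forall t, Q t.
Proof.
move=> Q0 QD t; have [x ->] := pi_t_surj t; rewrite -(freeg_sumE x).
elim: (dom x) => [|mn s IHs]; rewrite ?(big_nil, big_cons).
  by have -> : pi_t 0 = 0 by apply: (addrI (pi_t 0)); rewrite -pi_tD !addr0.
rewrite pi_tD.
have -> : << coeff mn x *g mn >> = coeff mn x *: << mn >> :> free.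
  by apply/eqP/freeg_eqP => k; rewrite coeffZ !coeffU mul1r.
by rewrite -pi_tZ; case: mn => m n; exact: QD.
Qed.

Lemma tensor_lift (V : lmodType S) (f : M -> N -> V) :
  (forall n, linear (f^~ n)) -> (forall m, linear (f m)) ->
  exists g : {linear tensor -> V}, forall m n, g (tens m n) = f m n.
Proof.
move=> fl fr; pose F (mn : M * N) := f mn.1 mn.2.
have FB : additive (fglift F) by exact: lift_is_additive.
have FD x y : fglift F (x + y) = fglift F x + fglift F y.
  have F0 : fglift F 0 = 0 by rewrite -(subrr 0) FB subrr.
  have FN z : fglift F (- z) = - fglift F z by rewrite -sub0r FB F0 sub0r.
  by rewrite -{1}[y]opprK FB FN opprK.
have FZ a x : fglift F (a *: x) = a *: fglift F x.
  have Fsum (r : seq (M * N)) c :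
      fglift F (\sum_(k <- r) << c k *g k >>) = \sum_(k <- r) c k *: F k.
    elim: r => [|k r IH]; last by rewrite !big_cons FD IH liftU.
    by rewrite !big_nil -(subrr 0) FB subrr.
  rewrite -{2}(freeg_sumE x) [a *: x]/(fgscale a x) /fgscale !Fsum scaler_sumr.
  by apply: eq_bigr => k _; rewrite scalerA.
have F0 x : tensor_rel x -> fglift F x = 0.
  elim=> [|a {}x y _ Fx _ Fy|a m m' n|a m n n'].
  - by rewrite -(subrr 0) FB subrr.
  - by rewrite FD FZ Fx Fy scaler0 addr0.
  - by rewrite FB FD FZ !liftU !scale1r /F /= fl subrr.
  - by rewrite FB FD FZ !liftU !scale1r /F /= fr subrr.
pose g (t : tensor) : V :=
  fglift F (generic_quotient.repr (t : {ideal_quot tensor_relb})).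
have g_pi x : g (pi_t x) = fglift F x.
  apply/eqP; rewrite -subr_eq0 -FB; apply/eqP/F0/asboolP.
  by apply/pi_tP; exact: reprK.
have gl : linear g.
  move=> a t u; have [x ->] := pi_t_surj t; have [y ->] := pi_t_surj u.
  by rewrite pi_tZ -pi_tD !g_pi FD FZ.
pose gM := GRing.isLinear.Build S tensor V *:%R g gl.
pose gL : {linear tensor -> V} := HB.pack g gM.
by exists gL => m n; rewrite /= g_pi liftU scale1r.
Qed.

End Tensor.

(* The span of all Schubert classes is the image of H_T^*(G/B) under          *)
(* restriction to the fixed points; rw gives the chosen reduced words.        *)
Notation HT_GB R rw := (span_type [set: weyl _] (schubert R rw)).
Notation HT_GP R J rw := (span_type (min_reps J) (schubert R rw)).
Notation HT_PB R J rw := (span_type (parabolic J) (schubert R rw)).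

(* Main.v *)
From HB Require Import structures.
Require Import Defs.
From mathcomp Require Import all_boot all_order all_fingroup all_algebra.
From mathcomp Require Import boolp reals complex.
From mathcomp Require Import freeg mpoly.
From mathcomp Require Import ring zify.

Set Implicit Arguments.
Unset Strict Implicit.
Unset Printing Implicit Defensive.

Import GRing.Theory Num.Theory.
Local Open Scope ring_scope.

(* H_T(G/B) is the ring of functions f : W -> S satisfying the GKM            *)
(* congruences f(s_b u) = f(u) mod b. Such an f of degree at most k that      *)
(* vanishes on all elements of length at most k is zero: at an element u of   *)
(* minimal length in its support it is divisible by the product of the        *)
(* inversions of u, of degree l(u). Hence at most one GKM function of degree  *)
(* at most l(v) vanishes at all u <> v with l(u) <= l(v) and equals the       *)
(* product of the inversions at v. One exists: starting from a v without      *)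
(* ascent, apply the divided differences D_i f(u) = (f(u s_i) - f(u)) /       *)
(* u(alpha_i), which preserve the GKM congruences. Expanding its values along *)
(* a word by means of D_i gives Billey's formula, so it is sigma_v, the       *)
(* formula does not depend on the reduced word (no braid relation is needed), *)
(* and triangularity makes the sigma_v a basis of the GKM functions.          *)
(* As D_i sigma_v is sigma_(v s_i) or 0, the sigma_v with v in W^P span the   *)
(* W_P-invariant GKM functions, over which the D_j with s_j in W_P are        *)
(* linear. Since D_y sigma_y = 1 and D_y sigma_x = 0 for x <> y no longer     *)
(* than y, subtracting from f the terms (D_y f) sigma_y with y in W_P of      *)
(* maximal length such that D_y f <> 0, and iterating, writes f uniquely as   *)
(* the sum of g_y sigma_y over y in W_P with invariant coefficients g_y.      *)

(** The Schubert classes are characterized without words: exactly one function satisfies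
    [schubert_spec v], by the degree bound [gkm_eq0] and by descent from the longest element
    ([schubert_spec_exists]), and [schubert_billey] identifies it with Billey's sum. Then
    [gkmV_span] and [schubert_free] turn H_T(G/B) into the GKM ring, while [schubert_invariant] and
    [invariant_span] turn H_T(G/P) into its W_P-invariants. The theorem becomes a Leray-Hirsch
    statement: the sigma_y with y in W_P form a basis of the GKM ring over the invariants
    ([leray_hirsch_span], [leray_hirsch_free]), the operators D_y extracting coefficients
    triangularly in the length. *)

(** * Root systems *)

Section Pairing.
Variable n : nat.
Implicit Types x y z : 'rV[int]_n.

Lemma pairing_is_linear y : linear_for *%R (fun x => pairing x y).
Proof.
move=> a x z; rewrite /pairing mulr_sumr -big_split /=.
by apply: eq_bigr => j _; rewrite !mxE mulrDl mulrA.
Qed.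

Lemma pairingDl x z y : pairing (x + z) y = pairing x y + pairing z y.
Proof. by have:= pairing_is_linear y 1 x z; rewrite scale1r mul1r. Qed.

Lemma pairing0l y : pairing 0 y = 0.
Proof. by rewrite /pairing big1 // => j _; rewrite mxE mul0r. Qed.

Lemma pairingZl a x y : pairing (a *: x) y = a * pairing x y.
Proof. by have:= pairing_is_linear y a x 0; rewrite pairing0l !addr0. Qed.

Lemma pairingNl x y : pairing (- x) y = - pairing x y.
Proof. by rewrite -scaleN1r pairingZl mulN1r. Qed.

Lemma pairingBl x z y : pairing (x - z) y = pairing x y - pairing z y.
Proof. by rewrite pairingDl pairingNl. Qed.

End Pairing.

Section Roots.
Variable D : rootDatum.
Implicit Types a b c d : root_type D.

Definition cartan b a : int := pairing (ssval b) (coroot (ssval a)).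

Lemma cartan_diag a : cartan a a = 2.
Proof. exact: pairing_coroot (ssvalP a). Qed.

Lemma ssval_neq0 a : ssval a != 0.
Proof.
apply/eqP => a0; have := cartan_diag a.
by rewrite /cartan a0 pairing0l.
Qed.

Lemma ssval_inj : injective (@ssval _ (Defs.roots D)).
Proof. exact: val_inj. Qed.

Lemma scale_root_eq0 (m : int) a : m *: ssval a = 0 -> m = 0.
Proof.
move=> /(congr1 (fun x => pairing x (coroot (ssval a)))).
by rewrite pairingZl pairing0l -/(cartan a a) cartan_diag; lia.
Qed.

Lemma ssval_reflection a b :
  ssval (reflection_fun a b) = ssval b - cartan b a *: ssval a.
Proof. by []. Qed.

Lemma cartan_reflectionl a b c :
  cartan (reflection_fun b c) a = cartan c a - cartan c b * cartan b a.
Proof. by rewrite /cartan ssval_reflection pairingBl pairingZl. Qed.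

(* The product t of the reflection s_d, d = s_a b, with s_a s_b s_a acts on   *)
(* the roots by t y = y + lambda(y) d with lambda(d) = 0, so finiteness of    *)
(* the root system forces lambda = 0.                                         *)
Lemma cartan_reflection a b c :
  cartan c (reflection_fun a b) = cartan (reflection_fun a c) b.
Proof.
set d := reflection_fun a b.
pose s x y := @reflection_fun D x y.
pose m x := pairing x (coroot (ssval d)).
pose m' x := pairing (x - pairing x (coroot (ssval a)) *: ssval a)
                     (coroot (ssval b)).
have sE x y : ssval (s x y) = ssval y - cartan y x *: ssval x by [].
have m'D x y k : m' (x + k *: y) = m' x + k * m' y.
  by rewrite /m' !(pairingDl, pairingBl, pairingZl, pairingNl); ring.
have mD x y k : m (x + k *: y) = m x + k * m y.
  by rewrite /m !(pairingDl, pairingZl).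
have m'd : m' (ssval d) = 2.
  rewrite -[m' _]/(cartan (reflection_fun a d) b) reflection_funK.
  exact: cartan_diag.
have md : m (ssval d) = 2 by exact: cartan_diag.
pose t y := s a (s b (s a (s d y))).
have tE y : ssval (t y) = ssval y + (m (ssval y) - m' (ssval y)) *: ssval d.
  have sss z : ssval (s a (s b (s a z))) = ssval z - m' (ssval z) *: ssval d.
    have mz : cartan (s a z) b = m' (ssval z) by [].
    have aa := cartan_diag a.
    rewrite !sE /cartan !(pairingBl, pairingZl) -!/(cartan _ _) aa.
    move: mz; rewrite /cartan sE !(pairingBl, pairingZl) -!/(cartan _ _) => ->.
    by apply/rowP=> j; rewrite !mxE; ring.
  rewrite /t sss sE -/(m (ssval y)) -scaleNr m'D m'd.
  by apply/rowP=> j; rewrite !mxE /cartan -/(m (ssval y)); ring.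
pose la := m (ssval c) - m' (ssval c).
have iE k : ssval (iter k t c) = ssval c + (k%:Z * la) *: ssval d.
  elim: k => [|k IH]; first by rewrite mul0r scale0r addr0.
  rewrite iterS tE IH mD m'D md m'd /la.
  by apply/rowP=> j; rewrite !mxE intS; ring.
suff la0 : la = 0 by apply/eqP; rewrite -subr_eq0 -/(m (ssval c)); apply/eqP.
apply/eqP/contraT => la_neq0.
suff: injective (fun k : 'I_(#|root_type D|.+1) => iter k t c).
  by move/leq_card; rewrite card_ord ltnn.
move=> k1 k2 /(congr1 (fun x => ssval x)); rewrite !iE => /addrI /eqP.
rewrite -subr_eq0 -scalerBl -mulrBl => /eqP /scale_root_eq0/eqP.
by rewrite mulf_eq0 (negPf la_neq0) orbF subr_eq0 => /eqP [] /val_inj.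
Qed.

Lemma reflection_fun_conj a b c :
  reflection_fun (reflection_fun a b) (reflection_fun a c) =
  reflection_fun a (reflection_fun b c).
Proof.
apply: ssval_inj; rewrite ssval_reflection cartan_reflection reflection_funK.
rewrite !ssval_reflection cartan_reflectionl.
by apply/rowP=> j; rewrite !mxE; ring.
Qed.

Definition neg_root a := reflection_fun a a.

Lemma ssval_neg a : ssval (neg_root a) = - ssval a.
Proof.
by rewrite ssval_reflection cartan_diag scaler_nat mulr2n opprD addNKr.
Qed.

Lemma neg_rootK : involutive neg_root.
Proof. by move=> a; apply: ssval_inj; rewrite !ssval_neg opprK. Qed.

Lemma reflection_neg a b : reflection_fun a (neg_root b) = neg_root (reflection_fun a b).
Proof. by rewrite /neg_root reflection_fun_conj. Qed.

Lemma cartan_negr b a : cartan b (neg_root a) = - cartan b a.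
Proof.
rewrite /neg_root cartan_reflection /cartan /= pairingBl pairingZl.
by rewrite -!/(cartan _ _) cartan_diag; ring.
Qed.

Lemma reflection_negl a b : reflection_fun (neg_root a) b = reflection_fun a b.
Proof.
apply: ssval_inj; rewrite ssval_reflection [RHS]ssval_reflection ssval_neg cartan_negr.
by rewrite scalerN scaleNr opprK.
Qed.

(* Proportionality of two roots forces the two Cartan integers to have        *)
(* product 4, and reducedness excludes the pairs (1, 4) and (4, 1).           *)
Lemma root_proportional a b :
  2 *: ssval a = cartan a b *: ssval b -> a = b \/ a = neg_root b.
Proof.
move=> ab; have := congr1 (fun x => pairing x (coroot (ssval a))) ab.
rewrite !pairingZl -!/(cartan _ _) cartan_diag.
set m := cartan a b in ab *; set m' := cartan b a => mm'.
have nred (x y : root_type D) : ssval x != 2 *: ssval y.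
  apply/eqP => xy; have := roots_reduced (ssvalP y).
  by rewrite -scaler_nat -xy ssvalP.
have two (x : root_type D) y : 2 *: ssval x = 2 *: y -> ssval x = y.
  by move/rowP=> E; apply/rowP=> j; have := E j; rewrite !mxE; exact: mulfI.
have : m = 1 \/ m = -1 \/ m = 2 \/ m = -2 \/ m = 4 \/ m = -4.
  have : (`|m| * `|m'| = 4)%N by rewrite -abszM -mm'.
  case: (leqP `|m| 4) => [|m4 E]; last first.
    have m'0 : (0 < `|m'|)%N by case: `|m'|%N E => //; rewrite muln0.
    suff : (4 < `|m| * `|m'|)%N by rewrite E.
    by rewrite (leq_trans m4) // leq_pmulr.
  by case mE: `|m|%N => [|[|[|[|[|//]]]]] _ E; lia.
case=> [mE|[mE|[mE|[mE|[mE|mE]]]]]; rewrite mE in ab.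
- by case/eqP: (nred b a); rewrite ab scale1r.
- by case/eqP: (nred (neg_root b) a); rewrite ssval_neg ab scaleN1r.
- by left; apply/ssval_inj/two.
- by right; apply/ssval_inj; rewrite ssval_neg; apply: two; rewrite ab scaleNr scalerN.
- case/eqP: (nred a b); apply: two; rewrite ab scalerA; congr (_ *: _).
- case/eqP: (nred a (neg_root b)); apply: two.
  rewrite ab ssval_neg scalerA scalerN -scaleNr.
  by congr (_ *: _).
Qed.

End Roots.

(** * Lengths and inversions in the Weyl group *)

Section PositiveRoots.
Variable D : rootDatum.
Implicit Types a b : root_type D.

Definition cone (x : 'rV[int]_(rank D)) : Prop :=
  exists c : 'I_(ss_rank D) -> nat, x = \sum_i simple i *+ c i.

Lemma coneD x y : cone x -> cone y -> cone (x + y).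
Proof.
move=> [c ->] [c' ->]; exists (fun i => c i + c' i)%N.
by rewrite -big_split /=; apply: eq_bigr => i _; rewrite mulrnDr.
Qed.

Lemma cone0 : cone 0.
Proof. by exists (fun=> 0%N); rewrite big1. Qed.

Lemma coneMn x n : cone x -> cone (x *+ n).
Proof.
by move=> cx; elim: n => [|n IH]; [exact: cone0|rewrite mulrS; exact: coneD].
Qed.

Definition pos b : bool := `[< cone (ssval b) >].

Lemma simple_comb_eq0 (c : 'I_(ss_rank D) -> nat) :
  \sum_i simple i *+ c i = 0 -> forall i, c i = 0%N.
Proof.
move=> c0 i; apply/eqP; rewrite -eqz_nat; apply/eqP.
apply: (simple_free (c := fun i => (c i)%:Z)).
by rewrite -[RHS]c0; apply: eq_bigr => k _; rewrite -scaler_nat natz.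
Qed.

(** If both [b] and its negative were in the cone, a sum of simple roots with natural coefficients
    would vanish, against [simple_free]; [simple_span] puts one of them there. *)
Lemma pos_neg b : pos (neg_root b) = ~~ pos b.
Proof.
apply/idP/idP => [/asboolP[c bc]|/asboolPn nb].
  apply/asboolPn => -[c' bc'].
  have /simple_comb_eq0 c0 : \sum_i simple i *+ (c' i + c i) = 0.
    under eq_bigr => i _ do rewrite mulrnDr.
    by rewrite big_split /= -bc -bc' ssval_neg subrr.
  case/eqP: (ssval_neq0 b); rewrite bc' big1 // => i _.
  by have /eqP := c0 i; rewrite addn_eq0 => /andP[/eqP-> _].
have [c [bc|bc]] := simple_span (ssvalP b); first by case: nb; exists c.
by apply/asboolP; exists c; rewrite ssval_neg bc opprK.
Qed.

Lemma pos_simple i : pos (simple_root i).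
Proof.
apply/asboolP; exists (fun k => (k == i) : nat).
rewrite (bigD1 i) //= eqxx big1 ?addr0 // => k /negPf->.
by rewrite mulr0n.
Qed.

(** s_i changes only the coefficient of alpha_i. If s_i b is negative, the other coefficients of [b]
    are 0, so [b] is proportional to alpha_i and, being positive, equal to it. *)
Lemma pos_srefl i b :
  pos b -> b != simple_root i -> pos (reflection_fun (simple_root i) b).
Proof.
move=> pb; apply: contraR; rewrite -pos_neg => /asboolP[c']; rewrite ssval_neg.
rewrite ssval_reflection /=; set m := cartan _ _ => E.
have /asboolP[c bc] := pb.
have c0 k : k != i -> c k = 0%N.
  (* This is b + (- s_i b) = m alpha_i, written in simple roots. *)
  move=> ki; have : \sum_k ((c k)%:Z + (c' k)%:Z - m * (k == i)%:R) *: simple k = 0.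
    under eq_bigr => l _ do rewrite scalerBl scalerDl.
    rewrite sumrB big_split /=.
    have natE (d : 'I_(ss_rank D) -> nat) :
        \sum_k (d k)%:Z *: simple k = \sum_k simple k *+ d k.
      by apply: eq_bigr => l _; rewrite -scaler_nat natz.
    rewrite !natE.
    rewrite -bc -E [X in _ - X](bigD1 i) //= eqxx big1; last first.
      by move=> l /negPf->; rewrite mulr0 scale0r.
    by rewrite mulr1 addr0 opprB addrCA subrr addr0 subrr.
  by move/simple_free/(_ k); rewrite (negPf ki) mulr0 subr0; lia.
have bE : ssval b = (c i)%:Z *: simple i.
  rewrite bc (bigD1 i) //= big1 ?addr0; last by move=> k /c0 ->; rewrite mulr0n.
  by rewrite -scaler_nat natz.
have mE : m = (c i)%:Z * 2.
  by rewrite -(cartan_diag (simple_root i)) /m /cartan bE pairingZl.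
have [->|bn] : b = simple_root i \/ b = neg_root (simple_root i).
- by apply: root_proportional; rewrite bE -/m mE scalerA mulrC.
- by [].
by move: pb; rewrite bn pos_neg pos_simple.
Qed.

End PositiveRoots.

Local Notation act := Defs.act.

Section WeylGroup.
Variables (D : rootDatum) (rw : weyl D -> seq 'I_(ss_rank D)).
Hypothesis rw_reduced : forall u : weyl D, reduced_word (rw u) u.
Implicit Types (a b g : root_type D) (u v w : weyl D) (s : seq 'I_(ss_rank D)).

Definition refl a : weyl D := subg (weyl_group D) (reflection a).

Lemma act_refl a b : act (refl a) b = reflection_fun a b.
Proof.
rewrite /act /refl subgK; last by apply/mem_gen/imset_f.
by apply: (@perm_inj _ (reflection a)); rewrite permKV permE reflection_funK.
Qed.

Lemma act1 b : act 1%g b = b.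
Proof. by rewrite /act invg1 perm1. Qed.

Lemma actK w : cancel (@act D w) (act w^-1%g).
Proof. by move=> b; rewrite -act_mul mulVg act1. Qed.

Lemma actKV w : cancel (act w^-1%g) (@act D w).
Proof. by move=> b; rewrite -act_mul mulgV act1. Qed.

Lemma act_faithful u v : act u =1 act v -> u = v.
Proof.
move=> uv; apply/val_inj/invg_inj/permP => b.
exact: uv.
Qed.

Lemma refl_mul a : (refl a * refl a = 1)%g.
Proof.
by apply: act_faithful => b; rewrite act_mul !act_refl reflection_funK act1.
Qed.

Lemma refl_inv a : (refl a)^-1%g = refl a.
Proof. by apply/eqP; rewrite eq_invg_mul refl_mul. Qed.

Lemma refl_negE a : refl (neg_root a) = refl a.
Proof. by apply: act_faithful => b; rewrite !act_refl reflection_negl. Qed.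

Lemma srefl_mul i : (srefl i * srefl i = 1 :> weyl D)%g.
Proof. exact: refl_mul. Qed.

Lemma srefl_inv i : ((srefl i : weyl D)^-1 = srefl i)%g.
Proof. exact: refl_inv. Qed.

Lemma mul_sreflK w i : (w * srefl i * srefl i = w)%g.
Proof. by rewrite -mulgA srefl_mul mulg1. Qed.

Lemma word_prod_nil : word_prod [::] = 1%g :> weyl D.
Proof. exact: big_nil. Qed.

Lemma word_prod_cons i s : word_prod (i :: s) = (srefl i * word_prod s)%g.
Proof. exact: big_cons. Qed.

Lemma word_prod_rcons i s : word_prod (rcons s i) = (word_prod s * srefl i)%g.
Proof. by rewrite /word_prod -cats1 big_cat big_seq1. Qed.

Lemma word_prod_rw w : word_prod (rw w) = w.
Proof. by have /andP[/eqP] := rw_reduced w. Qed.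

Lemma size_rw w : size (rw w) = length w.
Proof. by have /andP[_ /eqP] := rw_reduced w. Qed.

Lemma act_reflection w a b :
  act w (reflection_fun a b) = reflection_fun (act w a) (act w b).
Proof.
rewrite -(word_prod_rw w); elim: (rw w) a b => [|i s IH] a b.
  by rewrite word_prod_nil !act1.
by rewrite word_prod_cons !act_mul IH !act_srefl reflection_fun_conj.
Qed.

(** W consists of permutations of the roots, so the linearity of its action has to be recovered: it
    is clear for a simple reflection and passes along words. *)
Lemma act_sum w a (I : finType) (c : I -> nat) (b : I -> root_type D) :
  ssval a = \sum_k ssval (b k) *+ c k ->
  ssval (act w a) = \sum_k ssval (act w (b k)) *+ c k.
Proof.
rewrite -(word_prod_rw w); elim: (rw w) => [|i s IH] aE.
  by rewrite word_prod_nil act1 aE; apply: eq_bigr => k _; rewrite act1.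
rewrite word_prod_cons act_mul act_srefl ssval_reflection IH //.
under [RHS]eq_bigr => k _ do
  rewrite act_mul act_srefl ssval_reflection mulrnBl scalerMnl.
rewrite sumrB -scaler_suml; congr (_ - _ *: _).
rewrite /cartan IH //; elim/big_rec2: _ => [|k x y _ <-]; first exact: pairing0l.
by rewrite pairingDl; congr (_ + _); rewrite -scaler_nat pairingZl mulr_natl.
Qed.

Lemma act_neg w a : act w (neg_root a) = neg_root (act w a).
Proof. exact: act_reflection. Qed.

Lemma refl_act w a : (refl (act w a) * w = w * refl a)%g.
Proof.
by apply: act_faithful => b; rewrite !act_mul !act_refl act_reflection.
Qed.

(** Exchange condition: read along the word, the positive root g turns negative at some letter; just
    before, by [pos_srefl], it is the simple root of that letter, which can be deleted. The
    inclusion of letters keeps words inside J. *)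
Lemma deletion s g : pos g -> ~~ pos (act (word_prod s)^-1%g g) ->
  exists s', [/\ size s = (size s').+1, {subset s' <= s}
                & word_prod s' = (refl g * word_prod s)%g].
Proof.
elim: s g => [|i s IH] g pg; first by rewrite word_prod_nil invg1 act1 pg.
rewrite word_prod_cons invMg act_mul refl_inv act_srefl.
have [-> _|gi] := eqVneq g (simple_root i).
  exists s; split=> // [x xs|]; first by rewrite inE xs orbT.
  by rewrite mulgA srefl_mul mul1g.
move/(IH _ (pos_srefl pg gi)) => [s' [ss sub E]].
exists (i :: s'); split=> /=; first by rewrite ss.
  by move=> x; rewrite !inE => /orP[->//|/sub ->]; rewrite orbT.
rewrite word_prod_cons E -act_srefl !mulgA; congr (_ * _)%g.
by rewrite -refl_act !act_srefl reflection_funK.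
Qed.

Lemma length_word s : (length (word_prod s) <= size s)%N.
Proof.
rewrite leqNgt; apply/negP => lt_s.
have lt_iota : (size s < size (iota 0 #|weyl D|))%N.
  exact: leq_trans lt_s (find_size _ _).
have := before_find 0%N lt_s.
rewrite nth_iota ?add0n => [/existsP[]|]; last by rewrite size_iota in lt_iota.
by exists (in_tuple s).
Qed.

Lemma length1 : length (1%g : weyl D) = 0%N.
Proof. by apply/eqP; rewrite -leqn0 -word_prod_nil (length_word [::]). Qed.

Lemma length_eq0 w : (length w == 0%N) = (w == 1%g).
Proof.
apply/idP/eqP => [|->]; last by rewrite length1.
by rewrite -size_rw -{2}(word_prod_rw w) => /nilP ->; rewrite word_prod_nil.
Qed.

Lemma length_srefl_mul_le i w : (length (srefl i * w)%g <= (length w).+1)%N.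
Proof.
rewrite -{1}(word_prod_rw w) -word_prod_cons.
by rewrite (leq_trans (length_word _)) //= size_rw.
Qed.

Lemma length_srefl_le w i : (length (w * srefl i)%g <= (length w).+1)%N.
Proof.
rewrite -{1}(word_prod_rw w) -word_prod_rcons.
by rewrite (leq_trans (length_word _)) // size_rcons size_rw.
Qed.

Lemma length_refl_lt g w :
  pos g -> ~~ pos (act w^-1%g g) -> (length (refl g * w)%g < length w)%N.
Proof.
rewrite -[in act _ _](word_prod_rw w) => pg /(deletion pg)[s' [ss _ E]].
by rewrite -(size_rw w) ss ltnS -{1}(word_prod_rw w) -E length_word.
Qed.

Lemma length_refl_gt g w :
  pos g -> pos (act w^-1%g g) -> (length w < length (refl g * w)%g)%N.
Proof.
move=> pg pw; rewrite -{1}[w](mulKg (refl g)) refl_inv.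
apply: length_refl_lt => //; rewrite invMg act_mul refl_inv act_refl.
by rewrite -/(neg_root g) act_neg pos_neg pw.
Qed.

(** Since w s_i = s_g w for g = w(alpha_i), right multiplication becomes left multiplication by a
    reflection. *)
Lemma length_ascent w i : pos (act w (simple_root i)) ->
  length (w * srefl i)%g = (length w).+1.
Proof.
move=> p; apply/eqP; rewrite eqn_leq length_srefl_le /=.
by rewrite -[(w * _)%g]refl_act length_refl_gt // actK pos_simple.
Qed.

Lemma act_mul_srefl w i :
  act (w * srefl i)%g (simple_root i) = neg_root (act w (simple_root i)).
Proof. by rewrite act_mul act_srefl -act_neg. Qed.

Lemma length_descent w i : ~~ pos (act w (simple_root i)) ->
  length w = (length (w * srefl i)%g).+1.
Proof.
move=> p; rewrite -(length_ascent (i := i)) ?mul_sreflK //.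
by rewrite act_mul_srefl pos_neg.
Qed.

Lemma pos_ascent w i :
  pos (act w (simple_root i)) = (length w < length (w * srefl i)%g)%N.
Proof.
case: (boolP (pos _)) => [/length_ascent->|/length_descent->]; lia.
Qed.

Lemma weyl_ind (P : weyl D -> Prop) : P 1%g ->
  (forall u i, pos (act u (simple_root i)) -> P u -> P (u * srefl i)%g) ->
  forall w, P w.
Proof.
move=> P1 PS w; have [n] := ubnP (length w); elim: n => // n IH in w *.
rewrite ltnS => wn; have := size_rw w; have := word_prod_rw w.
case/lastP: (rw w) => [<- _|s i ws]; first by rewrite word_prod_nil.
rewrite size_rcons => sw; rewrite -ws word_prod_rcons.
have us : (length (word_prod s) <= size s)%N := length_word s.
apply: PS; last by apply: IH; rewrite (leq_ltn_trans us) // sw.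
by rewrite pos_ascent -word_prod_rcons ws -sw ltnS.
Qed.

(** This recursion on the last letter mirrors the action of D_i, which sends sigma_v to sigma_(v
    s_i) at a descent and to 0 at an ascent. *)
Lemma reduced_rcons s i v : reduced_word (rcons s i) v =
  ~~ pos (act v (simple_root i)) && reduced_word s (v * srefl i)%g.
Proof.
rewrite /reduced_word word_prod_rcons size_rcons.
have -> : (word_prod s * srefl i == v)%g = (word_prod s == v * srefl i)%g.
  by apply/eqP/eqP => [<-|->]; rewrite mul_sreflK.
case: eqP => [E|]; last by rewrite andbF.
case: (boolP (pos _)) => [/length_ascent|/length_descent ->]; last by rewrite eqSS.
have := length_word s; rewrite E => le1 le2 /=; lia.
Qed.

(** Letters are prepended one by one; when a letter shortens the product, [deletion] removes another
    letter instead. *)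
Lemma reduced_subword s : exists s', [/\ {subset s' <= s},
  word_prod s' = word_prod s & size s' = length (word_prod s)].
Proof.
elim: s => [|i s [s' [sub E sz]]].
  by exists [::]; rewrite word_prod_nil length1.
case: (boolP (pos (act (word_prod s')^-1%g (simple_root i)))) => p.
  exists (i :: s'); split.
  - by move=> x; rewrite !inE => /orP[->//|/sub ->]; rewrite orbT.
  - by rewrite !word_prod_cons E.
  apply/eqP; rewrite eqn_leq word_prod_cons -E /=; apply/andP; split.
    by rewrite sz -E (length_refl_gt (pos_simple i)).
  by rewrite -word_prod_cons length_word.
have [s'' [sz'' sub'' E'']] := deletion (pos_simple i) p.
exists s''; split.
- by move=> x /sub''/sub xs; rewrite inE xs orbT.
- by rewrite E'' word_prod_cons E.
apply/eqP; rewrite eqn_leq word_prod_cons -E -[srefl i]/(refl _) -E'' length_word andbT.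
rewrite -ltnS -sz'' sz -E.
have -> : word_prod s' = (srefl i * word_prod s'')%g.
  by rewrite E'' mulgA srefl_mul mul1g.
exact: length_srefl_mul_le.
Qed.

Lemma parabolic_word J y : y \in parabolic J ->
  exists s, {subset s <= J} /\ reduced_word s y.
Proof.
case/gen_prodgP => n [c cJ ->].
have [s [sJ <-]] : exists s, {subset s <= J} /\ word_prod s = (\prod_i c i)%g.
  elim: n c cJ => [|n IH] c cJ.
    by exists [::]; rewrite word_prod_nil big_ord0.
  have [s [sJ sE]] := IH (fun i => c (fintype.lift ord0 i)) (fun i => cJ _).
  have /imsetP[j jJ cj] := cJ ord0.
  exists (j :: s); rewrite word_prod_cons sE big_ord_recl -cj; split=> // x.
  by rewrite inE => /predU1P[->//|/sJ].
have [s' [sub E sz]] := reduced_subword s.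
by exists s'; rewrite /reduced_word E eqxx sz eqxx; split=> // x /sub/sJ.
Qed.

Lemma act_pos_longest w : (forall i, ~~ pos (act w (simple_root i))) ->
  forall a, pos a -> ~~ pos (act w a).
Proof.
move=> wn a /asboolP[c aE]; rewrite -pos_neg; apply/asboolP.
rewrite ssval_neg (act_sum w (b := @simple_root D) aE) -sumrN; apply: big_ind => [||k _].
- exact: cone0.
- exact: coneD.
rewrite -mulNrn -ssval_neg; apply/coneMn/asboolP.
by rewrite -/(pos _) pos_neg.
Qed.

(** These are the roots r(i, w) of a reduced word of w, as [inv_set_ascent] shows one letter at a
    time. *)
Definition inv_set w : {set root_type D} :=
  [set g | pos g && ~~ pos (act w^-1%g g)].

Lemma inv_set1 : inv_set 1%g = set0.
Proof. by apply/setP=> g; rewrite !inE invg1 act1 andbN. Qed.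

(** Applying s_i changes the sign of w^-1 g only when w^-1 g is alpha_i or its negative, and the
    latter would make g negative. *)
Lemma inv_set_ascent w i : pos (act w (simple_root i)) ->
  inv_set (w * srefl i)%g = act w (simple_root i) |: inv_set w.
Proof.
move=> p; apply/setP=> g; rewrite !inE invMg act_mul refl_inv act_srefl.
have [->|ng] := eqVneq g (act w (simple_root i)).
  by rewrite p actK -/(neg_root _) pos_neg pos_simple.
case pg: (pos g) => //=; set h := act w^-1%g g.
have hi : h != simple_root i.
  by apply: contra_neq ng => <-; rewrite actKV.
case ph: (pos h); first by rewrite pos_srefl.
rewrite -pos_neg -reflection_neg pos_srefl ?pos_neg ?ph //.
apply/eqP => /(congr1 (@neg_root D)); rewrite neg_rootK => hn.
by move: pg; rewrite -(actKV w g) -/h hn act_neg pos_neg p.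
Qed.

Lemma inv_set_ascentN w i : act w (simple_root i) \notin inv_set w.
Proof. by rewrite inE actK pos_simple andbF. Qed.

Lemma card_inv_set w : #|inv_set w| = length w.
Proof.
elim/weyl_ind: w => [|w i p IH]; first by rewrite inv_set1 cards0 length1.
by rewrite (inv_set_ascent p) cardsU1 inv_set_ascentN IH (length_ascent p).
Qed.

End WeylGroup.

(** * Roots as linear forms *)

Section LinearForms.
Variables (R : realType) (n : nat).
Local Notation S := {mpoly R[i][n]}.
Implicit Types (x y : 'rV[int]_n) (p q : S).

Definition linear_form x : S := \sum_j (x 0 j)%:~R *: 'X_j.

Lemma linear_formD x y : linear_form (x + y) = linear_form x + linear_form y.
Proof.
rewrite /linear_form -big_split; apply: eq_bigr => j _.
by rewrite mxE intrD scalerDl.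
Qed.

Lemma linear_formZ k x : linear_form (k *: x) = k%:~R *: linear_form x.
Proof.
rewrite /linear_form scaler_sumr; apply: eq_bigr => j _.
by rewrite mxE intrM scalerA.
Qed.

Lemma linear_formN x : linear_form (- x) = - linear_form x.
Proof. by rewrite -scaleN1r linear_formZ scaleN1r. Qed.

Lemma linear_form_eq0 x : linear_form x = 0 -> x = 0.
Proof.
move=> x0; apply/rowP=> j; rewrite mxE.
have /eqP := congr1 (mcoeff U_(j)) x0; rewrite /linear_form raddf_sum mcoeff0 /=.
rewrite (bigD1 j) //= mcoeffZ mcoeffXU eqxx mulr1 big1 ?addr0 => [|k /negPf kj].
  by rewrite intr_eq0 => /eqP.
by rewrite mcoeffZ mcoeffXU kj mulr0.
Qed.

(** [msize] is the degree plus one, here and in all bounds below. *)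
Lemma msize_linear_form x : x != 0 -> msize (linear_form x) = 2.
Proof.
move=> x0; apply/eqP; rewrite eqn_leq; apply/andP; split.
  apply: leq_trans (msize_sum _ _ _) _; apply/bigmax_leqP => j _.
  by apply: leq_trans (msizeZ_le _ _) _; rewrite msizeX mdeg1.
rewrite ltnNge; apply: contra x0 => /msize1_polyC E.
have E1 j : x 0 j = 0.
  have /eqP := congr1 (mcoeff U_(j)) E; rewrite /linear_form raddf_sum /=.
  rewrite mcoeffC mnm1_eq0 /= mulr0 (bigD1 j) //= mcoeffZ mcoeffXU eqxx mulr1.
  rewrite big1 ?addr0 => [|k /negPf kj]; first by rewrite intr_eq0 => /eqP.
  by rewrite mcoeffZ mcoeffXU kj mulr0.
by apply/eqP/rowP => j; rewrite E1 mxE.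
Qed.

(* Reduction modulo the linear form b: the variable X_j, paired to c_j by     *)
(* the coweight c, goes to X_j - (c_j / 2) b; for <b, c> = 2 this kills b.    *)
Definition reduce (b c : 'rV[int]_n) : S -> S :=
  comp_mpoly [tuple 'X_j - ((c 0 j)%:~R / 2) *: linear_form b | j < n].

HB.instance Definition _ b c := GRing.RMorphism.on (reduce b c).
HB.instance Definition _ b c := GRing.Linear.on (reduce b c).

Lemma reduce_linear_form b c x : reduce b c (linear_form x) =
  linear_form x - ((pairing x c)%:~R / 2) *: linear_form b.
Proof.
rewrite {1}/linear_form raddf_sum /= /pairing rmorph_sum mulr_suml scaler_suml.
rewrite -sumrB; apply: eq_bigr => j _.
rewrite linearZ /= /reduce comp_mpolyXU -tnth_nth tnth_mktuple scalerBr scalerA.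
by rewrite rmorphM /= mulrA.
Qed.

(** The congruence modulo b holds for the variables by the choice of [reduce], and is compatible
    with sums and products. *)
Lemma reduce_cong b c p : exists q, p = reduce b c p + linear_form b * q.
Proof.
pose C r := exists q, r = reduce b c r + linear_form b * q.
have CM r1 r2 : C r1 -> C r2 -> C (r1 * r2).
  move=> [q1 E1] [q2 E2].
  exists (q1 * reduce b c r2 + r1 * q2); rewrite rmorphM {1}E2 mulrDr {1}E1.
  by rewrite mulrDl -addrA [in RHS]mulrDr -mulrA [r1 * (_ * q2)]mulrCA.
elim/mpolyind: p => [|k m p _ _ [q pE]]; first by exists 0; rewrite raddf0 mulr0 addr0.
have [r mE] : C 'X_[m].
  rewrite mpolyXE_id; apply: big_ind => [|//|j _].
    by exists 0; rewrite rmorph1 mulr0 addr0.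
  elim: (m j) => [|l IH]; first by exists 0; rewrite expr0 rmorph1 mulr0 addr0.
  rewrite exprS; apply: CM IH; exists (((c 0 j)%:~R / 2) *: 1).
  by rewrite /reduce comp_mpolyXU -tnth_nth tnth_mktuple -scalerAr mulr1 subrK.
exists (k *: r + q); rewrite {1}pE {1}mE /reduce comp_mpolyD comp_mpolyZ.
by rewrite mulrDr -scalerAr scalerDr addrACA.
Qed.

Lemma reduce_mull b c q : pairing b c = 2 -> reduce b c (linear_form b * q) = 0.
Proof.
move=> bc; rewrite rmorphM /= reduce_linear_form bc.
have -> : (2%:~R / 2 : R[i]) = 1 by rewrite divff // pnatr_eq0.
by rewrite scale1r subrr mul0r.
Qed.

(** Together with [reduce_mull], this makes the ideal of b the kernel of [reduce] when b pairs to 2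
    with c, so that congruences modulo b become equalities. *)
Lemma reduce_eq0 b c p : reduce b c p = 0 -> exists q, p = linear_form b * q.
Proof. by move=> p0; have [q] := reduce_cong b c p; rewrite p0 add0r; exists q. Qed.

End LinearForms.

Section RootForms.
Variables (R : realType) (D : rootDatum).
Local Notation S := {mpoly R[i][rank D]}.
Implicit Types (a b c : root_type D) (p q : S).

Definition root_form b : S := linear_form R (ssval b).

Lemma root_form_neg b : root_form (neg_root b) = - root_form b.
Proof. by rewrite /root_form ssval_neg linear_formN. Qed.

Lemma root_form_neq0 b : root_form b != 0.
Proof. by apply/eqP => /linear_form_eq0/eqP; apply/negP/ssval_neq0. Qed.

Lemma msize_root_form b : msize (root_form b) = 2.
Proof. exact/msize_linear_form/ssval_neq0. Qed.

Definition reduce_root b : S -> S := reduce (ssval b) (coroot (ssval b)).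

HB.instance Definition _ b := GRing.RMorphism.on (reduce_root b).
HB.instance Definition _ b := GRing.Linear.on (reduce_root b).

Lemma reduce_root_mull b q : reduce_root b (root_form b * q) = 0.
Proof. exact: reduce_mull (cartan_diag b). Qed.

Lemma reduce_root_diag b : reduce_root b (root_form b) = 0.
Proof. by rewrite -[root_form b]mulr1 reduce_root_mull. Qed.

Lemma reduce_root_eq0 b p : reduce_root b p = 0 -> exists q, p = root_form b * q.
Proof. exact: reduce_eq0. Qed.

Lemma reduce_root_reflection b a :
  reduce_root b (root_form (reflection_fun b a)) = reduce_root b (root_form a).
Proof.
rewrite /root_form ssval_reflection -scaleNr linear_formD linear_formZ.
rewrite /reduce_root /reduce comp_mpolyD comp_mpolyZ.
by rewrite [X in _ *: X]reduce_root_diag scaler0 addr0.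
Qed.

Lemma reduce_root_neq0 b a : a <> b -> a <> neg_root b ->
  reduce_root b (root_form a) != 0.
Proof.
move=> ab anb; apply/eqP; rewrite [LHS]reduce_linear_form -/(cartan a b) => E.
suff : linear_form R (2 *: ssval a - cartan a b *: ssval b) = 0.
  by move/linear_form_eq0/eqP; rewrite subr_eq0 => /eqP/root_proportional[].
rewrite -scaleNr linear_formD !linear_formZ -[RHS](scaler0 _ 2) -[in RHS]E.
rewrite scalerBr scalerA mulrC divfK ?pnatr_eq0 //.
by rewrite rmorphN scaleNr.
Qed.

(* Distinct positive roots are pairwise coprime primes of S.                  *)
Lemma prod_roots_dvd (s : seq (root_type D)) p : uniq s -> all (@pos D) s ->
  {in s, forall b, reduce_root b p = 0} -> exists q, p = \prod_(b <- s) root_form b * q.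
Proof.
elim: s p => [|b s IH] p /=; first by exists p; rewrite big_nil mul1r.
move=> /andP[bs us] /andP[pb ps] p0.
have [|q pE] := IH p us ps; first by move=> c cs; apply: p0; rewrite inE cs orbT.
have /eqP := p0 b (mem_head _ _); rewrite pE rmorphM mulf_eq0 rmorph_prod /=.
case/orP => [|/eqP/reduce_root_eq0[r ->]]; last first.
  by exists r; rewrite big_cons mulrA; congr (_ * _); rewrite mulrC.
rewrite prodf_seq_eq0 => /hasP[c cs /andP[_]].
have [cb|cb] := eqVneq c b; first by rewrite -cb cs in bs.
rewrite (negPf (reduce_root_neq0 _ _)) //; first exact/eqP.
by move=> cE; have := allP ps c cs; rewrite cE pos_neg pb.
Qed.

Lemma msize_prod_roots (s : seq (root_type D)) :
  msize (\prod_(b <- s) root_form b) = (size s).+1.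
Proof.
elim: s => [|b s IH]; first by rewrite big_nil msize1.
have p0 : \prod_(b <- s) root_form b != 0.
  by rewrite -msize_poly_eq0 IH.
by rewrite big_cons msizeM ?root_form_neq0 // IH msize_root_form.
Qed.

End RootForms.

(** * Functions satisfying the GKM congruences *)

(* Transparent, these make [done] compare polynomials and lengths by           *)
(* computation, which does not terminate in practice.                         *)
#[local] Opaque Defs.length Defs.act srefl refl root_form reduce_root.

Section GKM.
Variables (R : realType) (D : rootDatum) (rw : weyl D -> seq 'I_(ss_rank D)).
Hypothesis rw_reduced : forall u : weyl D, reduced_word (rw u) u.
Local Notation S := {mpoly R[i][rank D]}.
Local Notation rf := (root_form R).
Implicit Types (a b : root_type D) (u v w : weyl D) (f g : weyl D -> S).

Definition gkm f := forall b u,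
  reduce_root b (f (refl b * u)%g) = reduce_root b (f u).

Definition inv_prod v : S := \prod_(b in inv_set v) rf b.

Lemma inv_prod_seq v : inv_prod v = \prod_(b <- enum (inv_set v)) rf b.
Proof. by rewrite big_enum. Qed.

Lemma msize_inv_prod v : msize (inv_prod v) = (length v).+1.
Proof.
by rewrite inv_prod_seq msize_prod_roots -cardE (card_inv_set rw_reduced).
Qed.

Lemma inv_prod_neq0 v : inv_prod v != 0.
Proof. by rewrite -msize_poly_eq0 msize_inv_prod. Qed.

(** For an inversion b of v the element s_b v is shorter, so f(v) is 0 modulo b; distinct inversions
    are coprime. *)
Lemma gkm_dvd f v : gkm f -> (forall u, (length u < length v)%N -> f u = 0) ->
  exists q, f v = inv_prod v * q.
Proof.
move=> gf f0; rewrite inv_prod_seq; apply: prod_roots_dvd.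
- exact: enum_uniq.
- by apply/allP=> b; rewrite mem_enum inE => /andP[].
move=> b; rewrite mem_enum inE => /andP[pb nb].
by rewrite -gf f0 ?raddf0 //; exact: (length_refl_lt rw_reduced pb nb).
Qed.

(** At a u of minimal length in the support, f(u) is divisible by l(u) roots, where l(u) is at least
    k while the degree of f(u) is below k. *)
Lemma gkm_eq0 f k : gkm f -> (forall u, msize (f u) <= k)%N ->
  (forall u, (length u < k)%N -> f u = 0) -> forall u, f u = 0.
Proof.
move=> gf df f0 u; have [n] := ubnP (length u); elim: n => // n IH in u *.
rewrite ltnS => un; case: (ltnP (length u) k) => [/f0//|ku].
have [q fE] := gkm_dvd gf (fun u' lt_u' => IH u' (leq_trans lt_u' un)).
have [q0|q0] := eqVneq q 0; first by rewrite fE q0 mulr0.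
have := df u; rewrite fE msizeM ?inv_prod_neq0 // msize_inv_prod.
have : (0 < msize q)%N by rewrite lt0n msize_poly_eq0.
case: (msize q) => // m _; rewrite addSn addnS /= => le_k.
by have := leq_trans le_k ku; rewrite ltnNge leq_addr.
Qed.

Lemma gkmD f g c : gkm f -> gkm g -> gkm (fun u => c * f u + g u).
Proof. by move=> gf gg b u; rewrite !rmorphD !rmorphM /= gf gg. Qed.

(** A relation and not a function, as the quotient need not exist for every f; it is unique by
    [divided_difference_inj]. *)
Definition divided_difference i f g := forall u,
  f (u * srefl i)%g - f u = rf (act u (simple_root i)) * g u.

Lemma divided_difference_inj i f g g' :
  divided_difference i f g -> divided_difference i f g' -> g =1 g'.
Proof.
move=> fg fg' u; apply: (mulfI (root_form_neq0 R (act u (simple_root i)))).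
by rewrite -fg -fg'.
Qed.

(** Passing from u to u s_i changes the sign of the numerator and of the root dividing it. *)
Lemma divided_difference_srefl i f g u :
  divided_difference i f g -> g (u * srefl i)%g = g u.
Proof.
move=> fg; apply: (mulfI (root_form_neq0 R (act u (simple_root i)))).
rewrite -fg; have := fg (u * srefl i)%g.
rewrite mul_sreflK (act_mul_srefl rw_reduced) root_form_neg mulNr => /eqP.
by rewrite -eqr_oppLR opprB => /eqP ->.
Qed.

(** With a = u(alpha_i), u s_i = s_a u, so the numerator vanishes modulo a. *)
Lemma divided_difference_exists i f : gkm f -> exists g, divided_difference i f g.
Proof.
move=> gf; suff /choice[g fg] : forall u, exists q,
  f (u * srefl i)%g - f u = rf (act u (simple_root i)) * q by exists g.
move=> u.
apply: reduce_root_eq0; rewrite rmorphB /= -[(u * _)%g](refl_act rw_reduced) gf.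
by rewrite subrr.
Qed.

(** For b different from a and -a, a can be cancelled modulo b, and the numerators at u and s_b u
    are congruent. For b = a or -a, s_b u = u s_i, where g has the same value. *)
Lemma divided_difference_gkm i f g : gkm f -> divided_difference i f g -> gkm g.
Proof.
move=> gf fg b u; set a := act u (simple_root i).
have uE : (refl a * u = u * srefl i)%g by exact: refl_act rw_reduced _ _.
have [ba|nba] := eqVneq b a.
  by rewrite ba uE (divided_difference_srefl _ fg).
have [bna|nbna] := eqVneq b (neg_root a).
  by rewrite bna refl_negE uE (divided_difference_srefl _ fg).
have ra0 : reduce_root b (rf a) != 0.
  apply: reduce_root_neq0; first by apply/eqP; rewrite eq_sym.
  by move=> ab; case/eqP: nbna; rewrite ab neg_rootK.
apply: (mulfI ra0); rewrite -[in RHS]rmorphM -fg rmorphB /=.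
rewrite -(reduce_root_reflection _ b a) -rmorphM -act_refl -act_mul -fg rmorphB /=.
by rewrite -mulgA !gf.
Qed.

Lemma divided_difference_msize i f g k u : divided_difference i f g ->
  (forall u, msize (f u) <= k.+1)%N -> (msize (g u) <= k)%N.
Proof.
move=> fg df; have [->|g0] := eqVneq (g u) 0; first by rewrite msize0.
have : (msize (rf (act u (simple_root i)) * g u) <= k.+1)%N.
  rewrite -fg; apply: leq_trans (msizeD_le _ _) _.
  by rewrite msizeN geq_max !df.
by rewrite msizeM ?root_form_neq0 // msize_root_form.
Qed.

Definition schubert_spec v f := [/\ gkm f,
  forall u, (msize (f u) <= (length v).+1)%N,
  forall u, (length u <= length v)%N -> u <> v -> f u = 0
  & f v = inv_prod v].

(** If u differs from v s_i and is no longer, f vanishes at both u and u s_i. At v s_i only f(v)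
    survives, and the division removes the inversion that v has in addition to those of v s_i. *)
Lemma schubert_spec_descent v f i g : ~~ pos (act v (simple_root i)) ->
  schubert_spec v f -> divided_difference i f g ->
  schubert_spec (v * srefl i)%g g.
Proof.
move=> nv [gf df f0 fv] fg; have lv := length_descent rw_reduced nv.
have pv : pos (act (v * srefl i)%g (simple_root i)).
  by rewrite (act_mul_srefl rw_reduced) pos_neg.
split.
- exact: divided_difference_gkm fg.
- by move=> u; apply: (divided_difference_msize u fg); rewrite -lv.
- move=> u lu uv; apply: (mulfI (root_form_neq0 R (act u (simple_root i)))).
  rewrite -fg mulr0.
  rewrite (f0 (u * srefl i)%g); first rewrite (f0 u).
  + exact: subrr.
  + by rewrite lv (leq_trans lu).
  + by move=> uE; move: lu; rewrite uE lv ltnn.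
  + by rewrite lv (leq_trans (length_srefl_le rw_reduced _ _)).
  by move=> uE; case: uv; rewrite -uE mul_sreflK.
apply: (mulfI (root_form_neq0 R (act (v * srefl i)%g (simple_root i)))).
rewrite -fg mul_sreflK fv f0 ?subr0; last first.
- by move=> E; move: lv; rewrite E; lia.
- by rewrite lv.
rewrite /inv_prod -{1}(mul_sreflK v i) (inv_set_ascent rw_reduced pv).
by rewrite big_setU1 ?inv_set_ascentN.
Qed.

(** D_i lowers the degree below l(v), and g still vanishes at all elements shorter than v, so
    [gkm_eq0] applies. *)
Lemma schubert_spec_ascent v f i g : pos (act v (simple_root i)) ->
  schubert_spec v f -> divided_difference i f g -> forall u, g u = 0.
Proof.
move=> pv [gf df f0 fv] fg; apply: (@gkm_eq0 g (length v)).
- exact: divided_difference_gkm fg.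
- by move=> u; exact: (divided_difference_msize u fg).
move=> u lu; apply: (mulfI (root_form_neq0 R (act u (simple_root i)))).
rewrite -fg mulr0 (f0 (u * srefl i)%g); first rewrite (f0 u).
- exact: subrr.
- exact: ltnW.
- by move=> uv; move: lu; rewrite uv ltnn.
- exact: leq_trans (length_srefl_le rw_reduced _ _) lu.
move=> uE; move: (length_ascent rw_reduced pv); rewrite -uE mul_sreflK.
by move=> E; move: lu; rewrite -uE E; lia.
Qed.

(** Descending induction on l(v): at an ascent i, D_i leads from v s_i down to v. *)
Lemma schubert_spec_exists v : exists f, schubert_spec v f.
Proof.
have [n] := ubnP (#|root_type D| - length v); elim: n => // n IH in v *.
rewrite ltnS => vn; case: (pselect (exists i, pos (act v (simple_root i)))).
  case=> i pv; have lv := length_ascent rw_reduced pv.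
  have := max_card (mem (inv_set (v * srefl i)%g)).
  rewrite (card_inv_set rw_reduced) lv => lt_v.
  have [|f sf] := IH (v * srefl i)%g; first by rewrite lv; lia.
  have [g fg] := divided_difference_exists i (let: And4 gf _ _ _ := sf in gf).
  exists g; rewrite -(mul_sreflK v i); apply: schubert_spec_descent fg => //.
  by rewrite (act_mul_srefl rw_reduced) pos_neg pv.
(* Without ascents, every positive root is an inversion of v; their product vanishes modulo every
   root, so the function supported at v alone is GKM. *)
move=> nv; have nv' i : ~~ pos (act v (simple_root i)).
  by apply/negP => pi; case: nv; exists i.
exists (fun u => if u == v then inv_prod v else 0); split.
- suff red0 b u : reduce_root b (if u == v then inv_prod v else 0) = 0.
    by move=> b u; rewrite !red0.
  case: eqP => _; last exact: rmorph0.
  have dvd c : pos c -> exists q, inv_prod v = rf c * q.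
    move=> pc; have cv : c \in inv_set v.
      rewrite inE pc /=; apply/negP => pvc.
      have := act_pos_longest rw_reduced nv' pvc.
      by rewrite actKV pc.
    exists (\prod_(b in inv_set v | b != c) rf b).
    by rewrite /inv_prod (bigD1 c).
  case: (boolP (pos b)) => [/dvd[q ->]|]; first exact: reduce_root_mull.
  rewrite -pos_neg => /dvd[q ->].
  by rewrite root_form_neg mulNr -mulrN reduce_root_mull.
- move=> u; case: eqP => _; first by rewrite msize_inv_prod.
  by rewrite msize0.
- by move=> u _ /eqP/negPf ->.
by rewrite eqxx.
Qed.

Lemma schubert_spec_inj v f g : schubert_spec v f -> schubert_spec v g -> f =1 g.
Proof.
move=> [gf df f0 fv] [gg dg g0 gv] u; apply/eqP; rewrite -subr_eq0; apply/eqP.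
rewrite addrC -mulN1r.
apply: (@gkm_eq0 (fun u => -1 * g u + f u) (length v).+1); first exact: gkmD.
  move=> w; apply: leq_trans (msizeD_le _ _) _.
  by rewrite mulN1r msizeN geq_max df dg.
move=> w lw; have [->|/eqP wv] := eqVneq w v; first by rewrite fv gv mulN1r addNr.
by rewrite f0 // g0 // mulr0 addr0.
Qed.

Lemma schubert_spec_step (F : weyl D -> weyl D -> S) v i :
  (forall v, schubert_spec v (F v)) ->
  divided_difference i (F v)
    (fun u => if pos (act v (simple_root i)) then 0 else F (v * srefl i)%g u).
Proof.
move=> FP; have [gF _ _ _] := FP v.
have [g Fg] := divided_difference_exists i gF.
case: (boolP (pos _)) => pv u; rewrite Fg; congr (_ * _).
  exact: schubert_spec_ascent pv (FP v) Fg u.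
exact: schubert_spec_inj (schubert_spec_descent pv (FP v) Fg) (FP _) u.
Qed.

Lemma inv_prod1 : inv_prod 1%g = 1.
Proof. by rewrite /inv_prod inv_set1 big_set0. Qed.

End GKM.

(** * Billey's formula *)

Section SubwordSum.
Variables (R : realType) (D : rootDatum) (rw : weyl D -> seq 'I_(ss_rank D)).
Hypothesis rw_reduced : forall u : weyl D, reduced_word (rw u) u.
Local Notation S := {mpoly R[i][rank D]}.
Local Notation rf := (root_form R).

(** Letters and factors are arbitrary families over the positions, so that the last position can be
    split off. *)
Definition subword_sum n (b : 'I_n -> 'I_(ss_rank D)) (r : 'I_n -> S)
    (v : weyl D) : S :=
  \sum_(K : {set 'I_n} | reduced_word [seq b k | k <- enum K] v) \prod_(k in K) r k.

Let widen n : 'I_n -> 'I_n.+1 := widen_ord (leqnSn n).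

Lemma widen_inj n : injective (@widen n).
Proof. by move=> i j /(congr1 val) /= ij; apply: val_inj. Qed.

Lemma widen_max n (i : 'I_n) : (widen i == ord_max) = false.
Proof. by apply/negP => /eqP /(congr1 val) /= E; have := ltn_ord i; rewrite E ltnn. Qed.

Lemma enum_set_filter (T : finType) (A : {set T}) :
  enum A = [seq x <- enum T | x \in A].
Proof. by rewrite !enumT. Qed.

Lemma enum_widen n (K : {set 'I_n}) :
  enum [set widen k | k in K] = [seq widen k | k <- enum K].
Proof.
rewrite enum_set_filter enum_ordSr filter_rcons.
case: imsetP => [[k _ /eqP]|_]; first by rewrite eq_sym widen_max.
rewrite filter_map [in RHS]enum_set_filter; congr map.
by apply: eq_filter => k /=; rewrite mem_imset //; exact: widen_inj.
Qed.

Lemma enum_widen_max n (K : {set 'I_n}) :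
  enum (ord_max |: [set widen k | k in K]) = rcons [seq widen k | k <- enum K] ord_max.
Proof.
rewrite enum_set_filter enum_ordSr filter_rcons setU11; congr rcons.
rewrite filter_map [in RHS]enum_set_filter; congr map.
apply: eq_filter => k /=; rewrite in_setU1 widen_max mem_imset //; exact: widen_inj.
Qed.

(** Sets of positions are split by whether they contain the last one; for those that do,
    [reduced_rcons] describes the condition on the remaining positions. *)
Lemma subword_sumS n b r v :
  @subword_sum n.+1 b r v =
  subword_sum (b \o @widen n) (r \o @widen n) v +
  r ord_max * (if pos (act v (simple_root (b ord_max))) then 0 else
     subword_sum (b \o @widen n) (r \o @widen n) (v * srefl (b ord_max))%g).
Proof.
have preK (K : {set 'I_n.+1}) : ord_max \notin K ->
    [set widen k | k in @widen n @^-1: K] = K.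
  move=> mK; apply/setP=> x; apply/imsetP/idP => [[k]|xK]; first by rewrite inE => ? ->.
  have xn : (x < n)%N.
    rewrite ltn_neqAle -ltnS ltn_ord andbT; apply: contraNneq mK => xn.
    by rewrite (_ : ord_max = x) //; apply: val_inj.
  have xE : widen (Ordinal xn) = x by apply: val_inj.
  by exists (Ordinal xn); rewrite ?inE xE.
have Kpre (K : {set 'I_n}) : @widen n @^-1: [set widen k | k in K] = K.
  by apply/setP=> k; rewrite inE mem_imset //; exact: widen_inj.
have maxK (K : {set 'I_n}) : ord_max \notin [set widen k | k in K].
  by apply/imsetP => -[k _ /eqP]; rewrite eq_sym widen_max.
rewrite /subword_sum (bigID (fun K : {set 'I_n.+1} => ord_max \notin K)) /=.
congr (_ + _).
  rewrite (reindex_onto (fun K : {set 'I_n} => [set widen k | k in K])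
             (fun K => @widen n @^-1: K)) /=; last by move=> K /andP[_ /preK].
  apply: eq_big => [K|K _].
    by rewrite Kpre eqxx maxK !andbT enum_widen -map_comp.
  by rewrite big_imset //= => i j _ _; exact: widen_inj.
rewrite (reindex_onto (fun K : {set 'I_n} => ord_max |: [set widen k | k in K])
           (fun K => @widen n @^-1: (K :\ ord_max))) /=; last first.
  by move=> K /andP[_]; rewrite negbK => mK; rewrite preK ?setD11 // setD1K.
have E (K : {set 'I_n}) :
    [&& reduced_word [seq b k | k <- enum (ord_max |: [set widen k | k in K])] v,
        ~~ (ord_max \notin ord_max |: [set widen k | k in K])
      & @widen n @^-1: ((ord_max |: [set widen k | k in K]) :\ ord_max) == K] =
    ~~ pos (act v (simple_root (b ord_max))) &&
    reduced_word [seq (b \o @widen n) k | k <- enum K] (v * srefl (b ord_max))%g.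
  rewrite setU11 /= setU1K // Kpre eqxx andbT enum_widen_max map_rcons.
  by rewrite (reduced_rcons rw_reduced) -map_comp.
under eq_bigl => K do rewrite -andbA E.
case: ifP => _ /=; first by rewrite big_pred0 // mulr0.
rewrite mulr_sumr; apply: eq_bigr => K _.
rewrite big_setU1 //= big_imset //= => i j _ _; exact: widen_inj.
Qed.

(* The recursion on the last letter of the word is the expansion of the       *)
(* values of F v along the divided differences, so it depends on the word     *)
(* only through its product.                                                  *)
Lemma subword_sum_schubert (F : weyl D -> weyl D -> S) :
  (forall v, schubert_spec v (F v)) -> forall n (b : 'I_n -> 'I_(ss_rank D)) v,
  subword_sum b (fun k => rf (act (word_prod [seq b j | j <- take k (enum 'I_n)])
                                  (simple_root (b k)))) v =
  F v (word_prod [seq b j | j <- enum 'I_n]).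
Proof.
move=> FP; elim=> [|n IH] b v.
  have K0 (K : {set 'I_0}) : K = set0 by apply/setP=> -[].
  rewrite [enum 'I_0](size0nil (size_enum_ord 0)) /= word_prod_nil /subword_sum.
  have rE (K : {set 'I_0}) : reduced_word [seq b k | k <- enum K] v = (v == 1%g).
    rewrite [K]K0 enum_set0 /= /reduced_word word_prod_nil eq_sym.
    by case: eqP => // ->; rewrite length1.
  rewrite (eq_bigl _ _ rE); have [->|/eqP v1] := eqVneq v 1%g.
    rewrite (big_pred1 set0) => [|K]; last by rewrite [K]K0 /= eqxx.
    by rewrite big_set0; have [_ _ _ ->] := FP 1%g; rewrite inv_prod1.
  rewrite big_pred0 //; have [_ _ F0 _] := FP v; rewrite F0 ?length1 //.
  by move/esym.
have takeE (k : nat) : (k <= n)%N -> [seq b j | j <- take k (enum 'I_n.+1)] =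
    [seq (b \o @widen n) j | j <- take k (enum 'I_n)].
  move=> kn; rewrite enum_ordSr -cats1 takel_cat; last by rewrite size_map size_enum_ord.
  by rewrite -map_take -map_comp.
set r := (X in subword_sum _ X _).
have rE : r \o @widen n = (fun k : 'I_n =>
    rf (act (word_prod [seq (b \o @widen n) j | j <- take k (enum 'I_n)])
            (simple_root ((b \o @widen n) k)))).
  by apply: funext => k; rewrite /r /= takeE // ltnW.
rewrite subword_sumS rE !IH /r takeE // take_oversize ?size_enum_ord //.
rewrite enum_ordSr map_rcons word_prod_rcons -map_comp.
(* What remains is F v (u s_i) - F v u = u(alpha_i) D_i(F v)(u), with i the last letter. *)
set u := word_prod _; apply/esym/eqP; rewrite addrC -subr_eq; apply/eqP.
exact: (schubert_spec_step rw_reduced v (b ord_max) FP u).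
Qed.

Lemma billey_schubert (F : weyl D -> weyl D -> S) s v :
  (forall v, schubert_spec v (F v)) -> billey R s v = F v (word_prod s).
Proof.
move=> FP; rewrite -[X in word_prod X](map_tnth_enum (in_tuple s)).
rewrite -subword_sum_schubert //; apply: eq_bigr => K _; apply: eq_bigr => k _.
by rewrite map_take map_tnth_enum.
Qed.

Lemma schubert_billey v :
  schubert_spec v (fun u => billey R (rw u) v).
Proof.
have [F FP] := choice (schubert_spec_exists R rw_reduced).
suff -> : (fun u => billey R (rw u) v) = F v by [].
by apply: funext => u; rewrite (billey_schubert _ _ FP) (word_prod_rw rw_reduced).
Qed.

End SubwordSum.

(** * The Schubert basis *)

Section SchubertBasis.
Variables (R : realType) (D : rootDatum) (rw : weyl D -> seq 'I_(ss_rank D)).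
Hypothesis rw_reduced : forall u : weyl D, reduced_word (rw u) u.
Local Notation S := {mpoly R[i][rank D]}.
Local Notation V := (weyl_fun R D).
Local Notation X := (schubert R rw).
Local Notation rf := (root_form R).
Implicit Types (u v w y : weyl D) (f g h : V) (s : seq 'I_(ss_rank D)).

Definition ev f u : S := (f : {ffun weyl D -> (symalg R D)^o}) u.

Lemma ev_ext f g : (forall u, ev f u = ev g u) -> f = g.
Proof. by move=> fg; apply/ffunP. Qed.

Lemma ev0 u : ev 0 u = 0.
Proof. by rewrite /ev ffunE. Qed.

Lemma evD f g u : ev (f + g) u = ev f u + ev g u.
Proof. by rewrite /ev ffunE. Qed.

Lemma evN f u : ev (- f) u = - ev f u.
Proof. by rewrite /ev ffunE. Qed.

Lemma evM f g u : ev (f * g) u = ev f u * ev g u.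
Proof. by rewrite /ev ffunE. Qed.

Lemma evZ (a : symalg R D) f u : ev (a *: f) u = (a : S) * ev f u.
Proof. by rewrite /ev ffunE. Qed.

Lemma weyl_fun_scaleAl (a : symalg R D) f g : (a *: f) * g = a *: (f * g).
Proof. by apply: ev_ext => u; rewrite evM evZ evZ evM mulrA. Qed.

Lemma weyl_fun_scaleAr (a : symalg R D) f g : f * (a *: g) = a *: (f * g).
Proof. by apply: ev_ext => u; rewrite evM evZ evZ evM mulrCA. Qed.

Lemma ev1 u : ev 1 u = 1.
Proof. by rewrite /ev ffunE. Qed.

Lemma ev_sum (I : finType) (A : {pred I}) (F : I -> V) u :
  ev (\sum_(k in A) F k) u = \sum_(k in A) ev (F k) u.
Proof. by apply: (big_morph (ev^~ u) (fun f g => evD f g u)); exact: ev0. Qed.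

Lemma schubertP v : schubert_spec v (ev (X v)).
Proof.
have -> : ev (X v) = fun u => billey R (rw u) v.
  by apply: funext => u; rewrite /ev ffunE.
exact: schubert_billey.
Qed.

Definition gkmV f := gkm (ev f).

Lemma gkmV0 : gkmV 0.
Proof. by move=> b u; rewrite !ev0. Qed.

Lemma gkmVD f g : gkmV f -> gkmV g -> gkmV (f + g).
Proof. by move=> gf gg b u; rewrite !evD !rmorphD /= gf gg. Qed.

Lemma gkmVN f : gkmV f -> gkmV (- f).
Proof. by move=> gf b u; rewrite !evN !rmorphN /= gf. Qed.

Lemma gkmVZ a f : gkmV f -> gkmV (a *: f).
Proof. by move=> gf b u; rewrite !evZ !rmorphM /= gf. Qed.

Lemma gkmVM f g : gkmV f -> gkmV g -> gkmV (f * g).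
Proof. by move=> gf gg b u; rewrite !evM !rmorphM /= gf gg. Qed.

Lemma gkmV_sum (I : finType) (A : {pred I}) (F : I -> V) :
  (forall k, k \in A -> gkmV (F k)) -> gkmV (\sum_(k in A) F k).
Proof. by move=> gF; apply: (big_ind gkmV); [exact: gkmV0|exact: gkmVD|exact: gF]. Qed.

Lemma gkmV_schubert v : gkmV (X v).
Proof. by have [] := schubertP v. Qed.

Lemma schubert1 : X 1%g = 1.
Proof.
apply: ev_ext; apply: (schubert_spec_inj rw_reduced (schubertP 1%g)).
split=> [b u|u|u|]; rewrite ?ev1 //.
- by rewrite msize1.
- rewrite length1 leqn0 (length_eq0 rw_reduced) => /eqP-> /(_ erefl) //.
by rewrite inv_prod1.
Qed.

#[local] Opaque gkm gkmV.

Lemma length_max u : (length u <= #|root_type D|)%N.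
Proof. by rewrite -(card_inv_set rw_reduced) max_card. Qed.

Lemma schubert_vanish v u :
  (length u <= length v)%N -> u <> v -> ev (X v) u = 0.
Proof. by have [_ _ + _] := schubertP v; apply. Qed.

Lemma schubert_diag v : ev (X v) v = inv_prod R v.
Proof. by have [] := schubertP v. Qed.

(** If f vanishes below length k, its values at length k are multiples of [inv_prod] by [gkm_dvd],
    so Schubert classes of length k remove them; [n] bounds the number of lengths left. *)
Lemma gkmV_span f : gkmV f -> exists c : weyl D -> symalg R D, f = \sum_w c w *: X w.
Proof.
suff H n k : gkmV f -> (forall u, (length u < k)%N -> ev f u = 0) ->
    (#|root_type D| < k + n)%N ->
    exists c : weyl D -> symalg R D, f = \sum_w c w *: X w.
  by move=> gf; exact: (H #|root_type D|.+1 0%N).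
elim: n k f => [|n IH] k f gf f0 nk.
  exists (fun=> 0); rewrite big1 => [|w _]; last exact: scale0r.
  apply: ev_ext => u; rewrite ev0; apply: f0.
  by rewrite addn0 in nk; exact: leq_ltn_trans (length_max u) nk.
have /choice[q qP] : forall w, exists q : symalg R D,
    (length w = k -> ev f w = inv_prod R w * q).
  move=> w; have [wk|wk] := eqVneq (length w) k; last first.
    by exists 0 => /eqP; rewrite (negPf wk).
  have [u|q fq] := @gkm_dvd _ _ _ rw_reduced (ev f) w gf.
    by rewrite wk; exact: f0.
  by exists q.
pose c w := if length w == k then q w else 0.
have gs : gkmV (\sum_w c w *: X w).
  by apply: gkmV_sum => w _; exact/gkmVZ/gkmV_schubert.
have [||| c' fE] := IH k.+1 (f - \sum_w c w *: X w).
- exact: gkmVD gf (gkmVN gs).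
- move=> u; rewrite ltnS => uk; rewrite evD evN ev_sum.
  rewrite (bigD1 u) //= big1 => [|w wu]; last first.
    rewrite evZ /c; case: eqP => [wk|_]; last exact: mul0r.
    rewrite schubert_vanish ?mulr0 ?wk //; exact/nesym/eqP.
  rewrite addr0 evZ /c schubert_diag; case: eqP => [/qP->|/eqP uk'].
    by rewrite mulrC subrr.
  by rewrite mul0r subr0 f0 // ltn_neqAle uk'.
- by rewrite addSnnS.
exists (fun w => c' w + c w).
rewrite -[LHS](subrK (\sum_w c w *: X w)) fE -big_split.
by apply: eq_bigr => w _; rewrite scalerDl.
Qed.

(** Evaluate at w: the other classes of index no shorter than w vanish there, and the coefficients
    of shorter indices are already 0. *)
Lemma schubert_free (A : {set weyl D}) (c : weyl D -> symalg R D) :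
  \sum_(w in A) c w *: X w = 0 -> forall w, w \in A -> c w = 0.
Proof.
move=> c0 w; have [n] := ubnP (length w); elim: n => // n IH in w *.
rewrite ltnS => wn wA; have := congr1 (fun f => ev f w) c0; rewrite ev0 ev_sum.
rewrite (bigD1 w) //= big1 => [|u /andP[uA uw]]; last first.
  rewrite evZ; case: (leqP (length w) (length u)) => wu.
    by rewrite schubert_vanish ?mulr0 //; exact/nesym/eqP.
  by rewrite IH ?mul0r // (leq_trans wu).
rewrite addr0 evZ schubert_diag => /eqP.
by rewrite mulf_eq0 (negPf (inv_prod_neq0 R rw_reduced w)) orbF => /eqP.
Qed.

(** The value 0 is a default where no divided difference exists; GKM functions always have one. *)
Definition dd i f : V :=
  if pselect (exists g : weyl D -> S, divided_difference i (ev f) g) is left h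
  then [ffun u => projT1 (cid h) u] else 0.

Lemma dd_spec i f : gkmV f -> divided_difference i (ev f) (ev (dd i f)).
Proof.
move=> gf; rewrite /dd; case: pselect => [h|[]].
  case: (cid h) => g gP /= u; rewrite gP; congr (_ * _).
  by rewrite /ev ffunE.
exact: (divided_difference_exists rw_reduced).
Qed.

#[local] Opaque dd.

Lemma dd_eq i f g : gkmV f -> divided_difference i (ev f) (ev g) -> dd i f = g.
Proof.
by move=> gf fg; apply: ev_ext; exact: divided_difference_inj (dd_spec i gf) fg.
Qed.

Lemma gkmV_dd i f : gkmV f -> gkmV (dd i f).
Proof. by move=> gf; exact: (divided_difference_gkm rw_reduced gf (dd_spec i gf)). Qed.

Lemma ddD i f g : gkmV f -> gkmV g -> dd i (f + g) = dd i f + dd i g.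
Proof.
move=> gf gg; apply: dd_eq => [|u]; first exact: gkmVD.
by rewrite !evD mulrDr -!dd_spec // opprD addrACA.
Qed.

Lemma ddM i h f : gkmV h -> gkmV f ->
  (forall u, ev h (u * srefl i)%g = ev h u) -> dd i (h * f) = h * dd i f.
Proof.
move=> gh gf hi; apply: dd_eq => [|u]; first exact: gkmVM.
by rewrite !evM hi mulrCA -dd_spec // mulrBr.
Qed.

Lemma ddZ i a f : gkmV f -> dd i (a *: f) = a *: dd i f.
Proof.
move=> gf; apply: dd_eq => [|u]; first exact: gkmVZ.
by rewrite !evZ mulrCA -dd_spec // mulrBr.
Qed.

Lemma dd0 i : dd i 0 = 0.
Proof. by apply: dd_eq => [|u]; [exact: gkmV0|rewrite !ev0 mulr0 subrr]. Qed.

Lemma dd_schubert i w :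
  dd i (X w) = if pos (act w (simple_root i)) then 0 else X (w * srefl i)%g.
Proof.
apply: dd_eq => [|u]; first exact: gkmV_schubert.
rewrite (schubert_spec_step rw_reduced w i schubertP u).
by case: ifP; rewrite ?ev0.
Qed.

Lemma dd_eq0 i h u : gkmV h -> dd i h = 0 -> ev h (u * srefl i)%g = ev h u.
Proof.
move=> gh h0; apply/eqP; rewrite -subr_eq0 (dd_spec i gh).
by rewrite h0 ev0 mulr0.
Qed.

(** The last letter acts first, as in the product of operators D_(i_1) ... D_(i_k). *)
Definition dd_word s f : V := foldr dd f s.

Lemma gkmV_dd_word s f : gkmV f -> gkmV (dd_word s f).
Proof. by move=> gf; elim: s => [|i s]; [exact: gf|exact: gkmV_dd]. Qed.

Lemma dd_word0 s : dd_word s 0 = 0.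
Proof. by elim: s => [|i s /= ->]; [by []|exact: dd0]. Qed.

Lemma dd_wordD s f g : gkmV f -> gkmV g ->
  dd_word s (f + g) = dd_word s f + dd_word s g.
Proof.
move=> gf gg; elim: s => [|i s /= ->]; first by [].
by apply: ddD; exact: gkmV_dd_word.
Qed.

Lemma dd_wordZ s a f : gkmV f -> dd_word s (a *: f) = a *: dd_word s f.
Proof.
move=> gf; elim: s => [|i s /= ->]; first by [].
by apply: ddZ; exact: gkmV_dd_word.
Qed.

Lemma dd_wordN s f : gkmV f -> dd_word s (- f) = - dd_word s f.
Proof. by move=> gf; rewrite -scaleN1r dd_wordZ // scaleN1r. Qed.

Lemma dd_word_sum s (I : finType) (A : {pred I}) (F : I -> V) :
  (forall k, k \in A -> gkmV (F k)) ->
  dd_word s (\sum_(k in A) F k) = \sum_(k in A) dd_word s (F k).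
Proof.
move=> gF; pose K (f g : V) := gkmV f /\ dd_word s f = g.
suff [] : K (\sum_(k in A) F k) (\sum_(k in A) dd_word s (F k)) by [].
apply: big_rec2 => [|k f g kA [gg <-]].
  by split; [exact: gkmV0|exact: dd_word0].
split; first exact: gkmVD (gF k kA) gg.
exact: dd_wordD (gF k kA) gg.
Qed.

Lemma dd_wordM s h f : gkmV h -> gkmV f ->
  (forall i u, i \in s -> ev h (u * srefl i)%g = ev h u) ->
  dd_word s (h * f) = h * dd_word s f.
Proof.
move=> gh gf; elim: s => [|i s IH] hs //=; rewrite IH => [|j u js]; last first.
  by apply: hs; rewrite inE js orbT.
apply: ddM gh (gkmV_dd_word s gf) _ => u.
by apply: hs; rewrite inE eqxx.
Qed.

Lemma length_mul_word u s : (length (u * word_prod s)%g <= length u + size s)%N.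
Proof.
rewrite -{1}(word_prod_rw rw_reduced u) /word_prod -big_cat.
by apply: leq_trans (length_word _) _; rewrite size_cat (size_rw rw_reduced).
Qed.

(** Each letter either shortens the index by one or kills the class, so the result is nonzero only
    if every letter is a descent when it acts. *)
Lemma dd_word_schubert s w : dd_word s (X w) =
  if (length (w * (word_prod s)^-1)%g + size s == length w)%N
  then X (w * (word_prod s)^-1)%g else 0.
Proof.
elim: s => [|i s IH] /=; first by rewrite word_prod_nil invg1 mulg1 addn0 eqxx.
have le_w : (length w <= length (w * (word_prod s)^-1)%g + size s)%N.
  by have := length_mul_word (w * (word_prod s)^-1)%g s; rewrite mulgKV.
rewrite IH word_prod_cons invMg mulgA srefl_inv; set w' := (w * _)%g in le_w *.
case: (boolP (pos (act w' (simple_root i)))) => p.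
  rewrite [LHS](_ : _ = 0).
    rewrite (length_ascent rw_reduced p) ifF //; apply/negP => /eqP E.
    by move: le_w; rewrite -E addSn addnS ltnNge leqW.
  by case: ifP => _; rewrite ?dd0 // dd_schubert p.
rewrite (length_descent rw_reduced p) addSn addnS.
case: (_.+1 == _); last exact: dd0.
by rewrite dd_schubert (negPf p).
Qed.

End SchubertBasis.

(** * Leray-Hirsch *)

#[local] Opaque gkm gkmV dd.

Section LerayHirsch.
Variables (R : realType) (D : rootDatum) (rw : weyl D -> seq 'I_(ss_rank D)).
Variable J : {set 'I_(ss_rank D)}.
Hypothesis rw_reduced : forall u : weyl D, reduced_word (rw u) u.
Local Notation S := {mpoly R[i][rank D]}.
Local Notation V := (weyl_fun R D).
Local Notation X := (schubert R rw).
Implicit Types (u v w y : weyl D) (f g h : V) (s : seq 'I_(ss_rank D)).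

Definition invariant_fun h :=
  forall j u, j \in J -> ev h (u * srefl j)%g = ev h u.

Lemma invariant_word h s u : invariant_fun h -> {subset s <= J} ->
  ev h (u * word_prod s)%g = ev h u.
Proof.
move=> hJ; elim: s u => [|i s IH] u sJ; first by rewrite word_prod_nil mulg1.
rewrite word_prod_cons mulgA IH => [|j js]; last by apply: sJ; rewrite inE js orbT.
by apply: hJ; apply: sJ; rewrite inE eqxx.
Qed.

Lemma invariant_dd_eq0 h : gkmV h ->
  (forall j, j \in J -> dd j h = 0) -> invariant_fun h.
Proof. by move=> gh h0 j u jJ; exact: (dd_eq0 rw_reduced u gh (h0 j jJ)). Qed.

Lemma dd_invariant h j : gkmV h -> invariant_fun h -> j \in J -> dd j h = 0.
Proof.
move=> gh hJ jJ; apply: (dd_eq rw_reduced gh) => u.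
by rewrite ev0 mulr0 hJ // subrr.
Qed.

Lemma word_prod_parabolic s : {subset s <= J} -> word_prod s \in parabolic J.
Proof.
elim: s => [|i s IH] sJ; first by rewrite word_prod_nil group1.
rewrite word_prod_cons groupM //.
  by apply/mem_gen/imset_f/sJ; rewrite inE eqxx.
by apply: IH => j js; apply: sJ; rewrite inE js orbT.
Qed.

Lemma min_reps_ascent v j : v \in min_reps J -> j \in J -> pos (act v (simple_root j)).
Proof.
rewrite inE => /forall_inP vmin jJ; apply/contraT => p.
have /vmin : srefl j \in parabolic J by apply/mem_gen/imset_f.
by rewrite (length_descent rw_reduced p) ltnn.
Qed.

Lemma schubert_invariant v : (forall j, j \in J -> pos (act v (simple_root j))) ->
  invariant_fun (X v).
Proof.
move=> vJ; apply: invariant_dd_eq0 (gkmV_schubert R rw_reduced v) _ => j jJ.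
by rewrite (dd_schubert R rw_reduced) vJ.
Qed.

(* The Schubert class of v is invariant under W_P on the right and does not   *)
(* vanish at v, hence at no v * x; but it vanishes at shorter elements.       *)
Lemma ascent_min_reps v : (forall j, j \in J -> pos (act v (simple_root j))) ->
  v \in min_reps J.
Proof.
move=> vJ; rewrite inE; apply/forall_inP => x xJ.
have [s [sJ /andP[/eqP<- _]]] := parabolic_word rw_reduced xJ.
rewrite leqNgt; apply/negP => lt_v.
have := invariant_word v (schubert_invariant vJ) sJ.
rewrite (schubert_vanish _ rw_reduced) ?(ltnW lt_v) //; last first.
  by move=> E; rewrite E ltnn in lt_v.
rewrite (schubert_diag _ rw_reduced) => /esym/eqP.
by rewrite (negPf (inv_prod_neq0 _ rw_reduced _)).
Qed.

(** For j in J, D_j g = 0, while D_j sends the sigma_w with a descent at j to distinct Schubert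
    classes and kills the others; freeness then annihilates the coefficients at descents, and
    [ascent_min_reps] places the remaining indices in W^P. *)
Lemma invariant_span g : gkmV g -> invariant_fun g ->
  exists c : weyl D -> symalg R D, g = \sum_(v in min_reps J) c v *: X v.
Proof.
move=> gg gJ; have [c gE] := gkmV_span rw_reduced gg; exists c.
have c0 j w : j \in J -> ~~ pos (act w (simple_root j)) -> c w = 0.
  move=> jJ pw; have := dd_invariant gg gJ jJ.
  have gX v : gkmV (c v *: X v) by exact/gkmVZ/gkmV_schubert.
  have -> : dd j g = dd_word [:: j] g by [].
  rewrite gE (dd_word_sum rw_reduced) => [|v _]; last exact: gX.
  rewrite (eq_bigr (fun v => (if pos (act v (simple_root j)) then 0 else c v)
                             *: X (v * srefl j)%g)) => [|v _]; last first.
    rewrite (dd_wordZ rw_reduced); last exact: gkmV_schubert.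
    rewrite [dd_word _ _](dd_schubert R rw_reduced).
    by case: ifP => _; rewrite ?scaler0 ?scale0r.
  rewrite (reindex_inj (mulIg (srefl j))) /=.
  under eq_bigr => v _ do rewrite mul_sreflK.
  rewrite -(eq_bigl _ _ (in_setT (T := weyl D))) => E.
  have := schubert_free rw_reduced E (in_setT (w * srefl j)%g).
  by rewrite mul_sreflK (negPf pw).
rewrite {1}gE (bigID (mem (min_reps J))) /= [X in _ + X]big1 ?addr0 // => w wJ.
suff -> : c w = 0 by exact: scale0r.
have [//|w0] := eqVneq (c w) 0; case/negP: wJ; apply: ascent_min_reps => j jJ.
by apply/contraT => /(c0 _ _ jJ)/eqP; rewrite (negPf w0).
Qed.

(** The membership condition stands under the existential so that choice yields a function on all of
    W. *)
Lemma reduced_parabolic y : exists s, y \in parabolic J ->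
  {subset s <= J} /\ reduced_word s y.
Proof.
have [/(parabolic_word rw_reduced)[s]|_] := boolP (y \in parabolic J).
  by exists s.
by exists [::].
Qed.

(** On Schubert classes, which span, [dd_word_schubert] involves only the product and the size of
    the word. *)
Lemma dd_word_reduced s s' f : gkmV f -> word_prod s = word_prod s' ->
  size s = size s' -> dd_word s f = dd_word s' f.
Proof.
move=> gf ps ss; have [c ->] := gkmV_span rw_reduced gf.
have gX v : gkmV (c v *: X v) by exact/gkmVZ/gkmV_schubert.
rewrite !(dd_word_sum rw_reduced) => [|v _|v _]; [|exact: gX..].
apply: eq_bigr => v _.
rewrite !(dd_wordZ rw_reduced) => [||]; [|exact: gkmV_schubert..].
by rewrite !(dd_word_schubert R rw_reduced) ps ss.
Qed.

(** With t the product of s, l(v) <= l(v t^-1) + l(t) < l(v t^-1) + size s, so no Schubert class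
    survives. *)
Lemma dd_word_nonreduced s f : gkmV f -> (length (word_prod s) < size s)%N ->
  dd_word s f = 0.
Proof.
move=> gf ns; have [c ->] := gkmV_span rw_reduced gf.
have gX v : gkmV (c v *: X v) by exact/gkmVZ/gkmV_schubert.
rewrite (dd_word_sum rw_reduced) => [|v _]; last exact: gX.
rewrite big1 // => v _; rewrite (dd_wordZ rw_reduced); last exact: gkmV_schubert.
rewrite (dd_word_schubert R rw_reduced) ifN ?scaler0 //.
set t := word_prod s in ns *; apply/negP => /eqP E.
have := length_mul_word rw_reduced (v * t^-1)%g (rw t).
rewrite (word_prod_rw rw_reduced) mulgKV (size_rw rw_reduced) -E leq_add2l.
by rewrite leqNgt ns.
Qed.

Lemma dd_word_schubert_same s y : (length y <= size s)%N ->
  dd_word s (X y) = if (y == word_prod s) && (length y == size s) then 1 else 0.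
Proof.
move=> ys; rewrite (dd_word_schubert R rw_reduced).
have [->|ny] := eqVneq y (word_prod s).
  by rewrite mulgV length1 add0n eq_sym (schubert1 R rw_reduced).
rewrite ifN //; apply/negP => /eqP E.
have : (length (y * (word_prod s)^-1)%g + size s <= 0 + size s)%N by rewrite E.
rewrite leq_add2r leqn0 (length_eq0 rw_reduced) -eq_mulgV1.
by rewrite (negPf ny).
Qed.

Lemma invariant_fun0 : invariant_fun 0.
Proof. by move=> j u _; rewrite !ev0. Qed.

Lemma invariant_funD g h : invariant_fun g -> invariant_fun h ->
  invariant_fun (g + h).
Proof. by move=> gJ hJ j u jJ; rewrite !evD gJ // hJ. Qed.

Lemma dd_word_invariantM s h f : gkmV h -> invariant_fun h -> gkmV f ->
  {subset s <= J} -> dd_word s (h * f) = h * dd_word s f.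
Proof.
move=> gh hJ gf sJ; apply: (dd_wordM rw_reduced gh gf) => i u /sJ.
exact: hJ.
Qed.

(** Induction on a k such that D_s kills f for all words s in J of size k; at k = 0 the empty word
    gives f = 0. *)
Lemma leray_hirsch_span f : gkmV f -> exists g : weyl D -> V,
  (forall y, gkmV (g y) /\ invariant_fun (g y)) /\
  f = \sum_(y in parabolic J) g y * X y.
Proof.
move=> gf; have /choice[r rP] := reduced_parabolic.
suff H k : forall f, gkmV f ->
    (forall s, {subset s <= J} -> size s = k -> dd_word s f = 0) ->
    exists g : weyl D -> V, (forall y, gkmV (g y) /\ invariant_fun (g y)) /\
    f = \sum_(y in parabolic J) g y * X y.
  apply: (H #|root_type D|.+1 f gf) => s _ ss; apply: dd_word_nonreduced gf _.
  by rewrite ss ltnS (length_max rw_reduced).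
elim: k => [|k IH] {gf} {}f gf f0.
  exists (fun=> 0); split=> [y|].
    by split; [exact: gkmV0|exact: invariant_fun0].
  rewrite -[LHS]/(dd_word [::] f) f0 //; rewrite big1 // => y _.
  exact: mul0r.
(* For l(y) = k, D_y f is W_P-invariant: applying D_j to it amounts to a word of size k + 1, which
   kills f. *)
pose g0 y := if (y \in parabolic J) && (length y == k) then dd_word (r y) f else 0.
have g0P y : gkmV (g0 y) /\ invariant_fun (g0 y).
  rewrite /g0; case: ifP => [/andP[yJ /eqP yk]|_]; last first.
    by split; [exact: gkmV0|exact: invariant_fun0].
  have [rJ /andP[_ /eqP sz]] := rP y yJ.
  have gd : gkmV (dd_word (r y) f) by exact: gkmV_dd_word.
  split; first exact: gd.
  apply: invariant_dd_eq0 gd _ => j jJ.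
  apply: (f0 (j :: r y)) => [x|]; last by rewrite /= sz yk.
  by rewrite inE => /predU1P[->|/rJ].
have gX y : gkmV (g0 y * X y).
  by apply: gkmVM; [case: (g0P y)|exact: gkmV_schubert].
have gS : gkmV (\sum_(y in parabolic J) g0 y * X y).
  by apply: gkmV_sum => y _; exact: gX.
have [||g [gP fE]] := IH (f - \sum_(y in parabolic J) g0 y * X y).
- exact: gkmVD gf (gkmVN gS).
(* Under D_s only the term of y = [word_prod s] can survive; it equals D_s f if s is reduced, and
   otherwise both are 0. *)
- move=> s sJ ss.
  rewrite (dd_wordD rw_reduced _ gf (gkmVN gS)) (dd_wordN rw_reduced _ gS).
  rewrite (dd_word_sum rw_reduced) => [|y _]; last exact: gX.
  have E y : dd_word s (g0 y * X y) = if y == word_prod s then g0 y else 0.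
    have [gy yJ] := g0P y.
    rewrite (dd_word_invariantM gy yJ (gkmV_schubert R rw_reduced y) sJ).
    case: (eqVneq (length y) k) => yk.
      rewrite dd_word_schubert_same ?yk ?ss // eqxx andbT.
      by case: (y == _); [exact: mulr1|exact: mulr0].
    rewrite /g0 (negPf yk) andbF mul0r.
    by case: ifP.
  have tJ := word_prod_parabolic sJ.
  have -> : \sum_(y in parabolic J) dd_word s (g0 y * X y) = g0 (word_prod s).
    under eq_bigr => y _ do rewrite E.
    rewrite -big_mkcondr /=.
    by apply: big_pred1 => y /=; case: eqP => [->|]; rewrite ?tJ ?andbF.
  rewrite /g0 tJ andTb; case: (eqVneq (length (word_prod s)) k) => tk.
    have [_ /andP[/eqP pr /eqP sz]] := rP _ tJ.
    have rs : size (r (word_prod s)) = size s by rewrite sz tk ss.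
    by rewrite (dd_word_reduced gf pr rs) subrr.
  rewrite (dd_word_nonreduced gf); first exact: subrr.
  by rewrite ltn_neqAle length_word ss tk.
exists (fun y => g y + g0 y); split=> [y|].
  have [? ?] := gP y; have [? ?] := g0P y.
  by split; [exact: gkmVD|exact: invariant_funD].
rewrite -[LHS](subrK (\sum_(y in parabolic J) g0 y * X y)) fE -big_split.
by apply: eq_bigr => y _; rewrite mulrDl.
Qed.

(** Descending induction on l(y): D_y, linear over the invariants, sends g_y sigma_y to g_y and
    kills the other terms of index no longer than y, while longer indices already have coefficient
    0. *)
Lemma leray_hirsch_free (g : weyl D -> V) :
  (forall y, gkmV (g y) /\ invariant_fun (g y)) ->
  \sum_(y in parabolic J) g y * X y = 0 -> {in parabolic J, forall y, g y = 0}.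
Proof.
move=> gP g0 y; have [n] := ubnP (#|root_type D| - length y).
elim: n => // n IH in y *; rewrite ltnS => yn yJ.
have [s [sJ /andP[/eqP ps /eqP ss]]] := parabolic_word rw_reduced yJ.
have := congr1 (dd_word s) g0.
rewrite (dd_word0 R rw_reduced) (dd_word_sum rw_reduced) => [|y' _]; last first.
  by apply: gkmVM; [case: (gP y')|exact: gkmV_schubert].
have E y' : y' \in parabolic J ->
    dd_word s (g y' * X y') = if y' == y then g y' else 0.
  move=> y'J; have [gy' y'inv] := gP y'.
  rewrite (dd_word_invariantM gy' y'inv (gkmV_schubert R rw_reduced y') sJ).
  have [le_y|lt_y] := leqP (length y') (length y).
    rewrite dd_word_schubert_same ?ss // ps.
    have [->|_] := eqVneq y' y; first by rewrite eqxx mulr1.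
    exact: mulr0.
  rewrite (IH y') ?mul0r //; first by case: ifP.
  apply: leq_trans yn; apply: (ltn_sub2l _ lt_y).
  exact: leq_trans lt_y (length_max rw_reduced y').
rewrite (eq_bigr _ E) -big_mkcondr /= => <-; apply/esym/big_pred1 => y'.
by rewrite /=; case: eqP => [->|]; rewrite ?yJ ?andbF.
Qed.

End LerayHirsch.

(** * Spans, tensors and the multiplication map *)

Section SpanType.
Variables (T : comNzRingType) (V : lmodType T) (I : finType).
Variables (A : {set I}) (e : I -> V).

Definition span_val (x : span_type A e) : V := val x.

Lemma span_val_inj : injective span_val.
Proof. exact: val_inj. Qed.

Lemma span_valP x : span_val x \in mspan A e.
Proof. exact: valP. Qed.

Lemma span_val0 : span_val 0 = 0.
Proof. exact: raddf0. Qed.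

Lemma span_valZ a x : span_val (a *: x) = a *: span_val x.
Proof. exact: linearZ. Qed.

Lemma span_valD x y : span_val (x + y) = span_val x + span_val y.
Proof. exact: raddfD. Qed.

Lemma span_val_sum (K : finType) (B : {set K}) (x : K -> span_type A e) :
  span_val (\sum_(k in B) x k) = \sum_(k in B) span_val (x k).
Proof. by apply: (big_morph span_val); [exact: span_valD|exact: span_val0]. Qed.

Lemma span_val_surj f : f \in mspan A e -> exists x, span_val x = f.
Proof. by move=> fA; exists (Sub f fA); exact: SubK. Qed.

Lemma mem_mspan i : i \in A -> e i \in mspan A e.
Proof.
move=> iA; apply/asboolP; exists (fun k => (k == i)%:R).
rewrite (bigD1 i) //= eqxx scale1r big1 ?addr0 // => k /andP[_ /negPf->].
exact: scale0r.
Qed.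

Definition span_gen i : span_type A e := insubd 0 (e i).

Lemma span_val_gen i : i \in A -> span_val (span_gen i) = e i.
Proof. by move=> iA; rewrite /span_val insubdK //; exact: mem_mspan. Qed.

Lemma span_type_gen (x : span_type A e) :
  exists c : I -> T, x = \sum_(i in A) c i *: span_gen i.
Proof.
have /asboolP[c xE] := span_valP x; exists c; apply: span_val_inj.
rewrite xE span_val_sum; apply: eq_bigr => i iA.
by rewrite span_valZ span_val_gen.
Qed.

End SpanType.

Section Tensors.
Variables (T : comNzRingType) (M : lmodType T) (N : lmodType T).

Lemma tens0l (n : N) : tens (0 : M) n = 0.
Proof. by have := tensDl (-1) (0 : M) 0 n; rewrite scaler0 addr0 scaleN1r addNr. Qed.

Lemma tens0r (m : M) : tens m (0 : N) = 0.
Proof. by have := tensDr (-1) m (0 : N) 0; rewrite scaler0 addr0 scaleN1r addNr. Qed.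

Lemma tensZr a (m : M) (n : N) : tens m (a *: n) = a *: tens m n.
Proof. by have := tensDr a m n 0; rewrite tens0r !addr0. Qed.

Lemma tens_sumr (I : finType) (A : {set I}) m (n : I -> N) :
  tens (m : M) (\sum_(i in A) n i) = \sum_(i in A) tens m (n i).
Proof.
apply: (big_morph (tens m)); last exact: tens0r.
by move=> x y; have := tensDr 1 m x y; rewrite !scale1r.
Qed.

(** Expanding right factors on the generators and moving scalars to the left collects one element of
    M per generator. *)
Lemma tensor_gen (I : finType) (A : {set I}) (e : I -> N) :
  (forall n, exists c : I -> T, n = \sum_(i in A) c i *: e i) ->
  forall t : tensor M N, exists p : I -> M, t = \sum_(i in A) tens (p i) (e i).
Proof.
move=> eP; elim/tensor_ind => [|a m n t [p ->]].
  by exists (fun=> 0); rewrite big1 // => i _; exact: tens0l.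
have [c ->] := eP n; exists (fun i => (a * c i) *: m + p i).
rewrite tens_sumr scaler_sumr -big_split; apply: eq_bigr => i _ /=.
by rewrite tensDl tensZr scalerA.
Qed.

End Tensors.

Section Multiplication.
Variables (R : realType) (D : rootDatum) (rw : weyl D -> seq 'I_(ss_rank D)).
Variable J : {set 'I_(ss_rank D)}.
Hypothesis rw_reduced : forall u : weyl D, reduced_word (rw u) u.

Lemma gkmV_mspan (A : {set weyl D}) f : f \in mspan A (schubert R rw) -> gkmV f.
Proof.
move=> /asboolP[c ->]; apply: gkmV_sum => w _.
exact/gkmVZ/gkmV_schubert.
Qed.

Lemma mspan_gkmV f : gkmV f -> f \in mspan [set: weyl D] (schubert R rw).
Proof.
move=> /(gkmV_span rw_reduced)[c ->]; apply/asboolP; exists c.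
by apply: eq_bigl => w; rewrite inE.
Qed.

Lemma gkmV_val (A : {set weyl D}) (p : span_type A (schubert R rw)) :
  gkmV (span_val p).
Proof. exact: gkmV_mspan (span_valP p). Qed.

Lemma invariant_val (p : HT_GP R J rw) : invariant_fun J (span_val p).
Proof.
have /asboolP[c ->] := span_valP p; apply: (big_ind (invariant_fun J)).
- exact: invariant_fun0.
- exact: invariant_funD.
move=> v vJ j u jJ; rewrite !evZ; congr (_ * _).
apply: (schubert_invariant R rw_reduced _ u jJ) => k kJ.
exact: (min_reps_ascent rw_reduced vJ).
Qed.

Definition span_mul (p : HT_GP R J rw) (q : HT_PB R J rw) : HT_GB R rw :=
  Sub (span_val p * span_val q) (mspan_gkmV (gkmVM (gkmV_val p) (gkmV_val q))).

Lemma val_span_mul p q : span_val (span_mul p q) = span_val p * span_val q.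
Proof. exact: SubK. Qed.

Lemma span_mul_linearl q : linear (span_mul^~ q).
Proof.
move=> a p p'; apply: span_val_inj.
rewrite span_valD span_valZ !val_span_mul span_valD span_valZ mulrDl.
by rewrite weyl_fun_scaleAl.
Qed.

Lemma span_mul_linearr p : linear (span_mul p).
Proof.
move=> a q q'; apply: span_val_inj.
rewrite span_valD span_valZ !val_span_mul span_valD span_valZ mulrDr.
by rewrite weyl_fun_scaleAr.
Qed.

End Multiplication.

Theorem theorem1p1 (R : realType) (D : rootDatum)
  (J : {set 'I_(ss_rank D)})
  (rw : weyl D -> seq 'I_(ss_rank D))
  (rw_reduced : forall u : weyl D, reduced_word (rw u) u) :
  exists phi : {linear tensor (HT_GP R J rw) (HT_PB R J rw) -> HT_GB R rw},
    bijective phi /\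
    forall (p : HT_GP R J rw) (q : HT_PB R J rw),
      val (phi (tens p q)) = val p * val q.
Proof.
have [phi phiE] := @tensor_lift (symalg R D) (HT_GP R J rw) (HT_PB R J rw)
  (HT_GB R rw) _ (span_mul_linearl rw_reduced) (span_mul_linearr rw_reduced).
have phiV p q : span_val (phi (tens p q)) = span_val p * span_val q.
  by rewrite phiE; exact: val_span_mul.
exists phi; split; last exact: phiV.
pose e : weyl D -> HT_PB R J rw := span_gen (parabolic J) (schubert R rw).
have phi_sum (p : weyl D -> HT_GP R J rw) :
    span_val (phi (\sum_(y in parabolic J) tens (p y) (e y))) =
    \sum_(y in parabolic J) span_val (p y) * schubert R rw y.
  rewrite raddf_sum span_val_sum; apply: eq_bigr => y yJ.
  by rewrite phiV span_val_gen.
(* With t the sum of the p_y tensor sigma_y, its image is the sum of the p_y sigma_y, and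
   [leray_hirsch_free] makes every p_y vanish. *)
have phi_inj : injective phi.
  apply: raddf_inj => t t0.
  have [p tE] := tensor_gen (@span_type_gen _ _ _ _ _) t.
  rewrite tE; apply: big1 => y yJ.
  have p0 : span_val (p y) = 0.
    apply: (leray_hirsch_free rw_reduced (J := J) (g := fun y => span_val (p y))) yJ.
      by move=> z; split; [exact: gkmV_val|exact: invariant_val].
    by rewrite -phi_sum -tE t0 span_val0.
  suff -> : p y = 0 by exact: tens0l.
  by apply: span_val_inj; rewrite p0 span_val0.
(* The invariant coefficients from [leray_hirsch_span] lie in H_T(G/P) by [invariant_span]. *)
have phi_surj z : exists t, phi t = z.
  have [g [gP zE]] := leray_hirsch_span J rw_reduced (gkmV_val rw_reduced z).
  have /choice[p pE] : forall y, exists p : HT_GP R J rw, span_val p = g y.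
    move=> y; have [gy yJ] := gP y.
    have [c cE] := invariant_span rw_reduced gy yJ.
    by apply: span_val_surj; apply/asboolP; exists c.
  exists (\sum_(y in parabolic J) tens (p y) (e y)); apply: span_val_inj.
  by rewrite phi_sum zE; apply: eq_bigr => y _; rewrite pE.
have [psi psiK] := choice phi_surj.
by exists psi => // t; apply: phi_inj; rewrite psiK.
Qed.
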